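(* Let $\ell\ge1$ be an integer and let $h:(0,1)\to(0,\infty)$ be a continuous function with $\lim_{t\to 0^+}h(t)=0$. Let $(z_n)_{n\ge 1}$, $z_n=r_ne^{i\theta_n}$ with $r_n\in(0,1)$ and $\theta_n\in\mathbb{R}$, be a Blaschke sequence in the unit disc $\mathbb{D}$ such that $\sum_{n=1}^{\infty}h(1-r_n)<\infty$, and let $B$ be the Blaschke product with zeros $(z_n)_{n\ge1}$. Suppose that there is $q\in(1/(\ell+1),1/\ell]$ such that $h(t)/t^{q}$ is decreasing and $h(t)/t^{1-\ell q}$ is increasing on $(0,1)$. Then, for any $p\ge q$, \[ \int_{0}^{2\pi}|B^{(\ell)}(re^{i\theta})|^{p}\,d\theta=\frac{O(1)}{(1-r)^{\ell p-1}\,h(1-r)}\qquad (r\to1^-), \] where $B^{(\ell)}$ is the $\ell$-th derivative of $B$. Moreover, if $\lim_{t\to0^+}h(t)/t^{1-\ell q}=0$, then $O(1)$ can be replaced by $o(1)$, i.e. for any $p\ge q$, \[ \int_{0}^{2\pi}|B^{(\ell)}(re^{i\theta})|^{p}\,d\theta=\frac{o(1)}{(1-r)^{\ell p-1}\,h(1-r)}\qquad (r\to1^-). \]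
   Context: $\mathbb{D}$ is the open unit disc in $\mathbb{C}$. A Blaschke sequence is a sequence $(z_n)_{n\ge1}$ in $\mathbb{D}\setminus\{0\}$ with $\sum_{n}(1-|z_n|)<\infty$; the Blaschke product with these zeros is $B(z)=\prod_{n=1}^{\infty}\frac{|z_n|}{z_n}\,\frac{z_n-z}{1-\bar z_n z}$, $z\in\mathbb{D}$, which is analytic and bounded by $1$ on $\mathbb{D}$. ''Increasing'' and ''decreasing'' are understood in the weak (non-strict) sense. *)

(* Defs.v *)
From Stdlib Require Import Reals.
From Coquelicot Require Import Coquelicot.
Open Scope R_scope.

Definition polar (r theta : R) : C := (r * cos theta, r * sin theta).

(* [Rpower 0 p] is [1] in Stdlib; here [0 ^ p = 0], the right value for [p > 0],
   so that this can be applied to a modulus that may vanish. *)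
Definition rpow (x p : R) : R := if Rlt_dec 0 x then Rpower x p else 0.

Definition weakly_decreasing_on (a b : R) (f : R -> R) : Prop :=
  forall s t, a < s -> s <= t -> t < b -> f t <= f s.

Definition weakly_increasing_on (a b : R) (f : R -> R) : Prop :=
  forall s t, a < s -> s <= t -> t < b -> f s <= f t.

(* The companion of Coquelicot's [is_domin F g f], which is [f = o(g)] along [F]. *)
Definition is_bigO (F : (R -> Prop) -> Prop) (g f : R -> R) : Prop :=
  exists M : R, F (fun x => Rabs (f x) <= M * Rabs (g x)).

(* Sequences are indexed from [0]: [z 0] is the first zero. *)
Definition Blaschke_sequence (z : nat -> C) : Prop :=
  (forall n, z n <> 0%C /\ Cmod (z n) < 1) /\
  ex_series (fun n => 1 - Cmod (z n)).

Definition Blaschke_factor (a w : C) : C :=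
  ((RtoC (Cmod a) / a) * ((a - w) / (1 - Cconj a * w)))%C.

Fixpoint Blaschke_partial (z : nat -> C) (N : nat) (w : C) : C :=
  match N with
  | O => 1%C
  | S n => (Blaschke_partial z n w * Blaschke_factor (z n) w)%C
  end.

(* Coquelicot has no limit operator for complex sequences, so the limit of the
   partial products is taken componentwise, as [C_lim] does for functions. *)
Definition Blaschke_product (z : nat -> C) (w : C) : C :=
  (real (Lim_seq (fun N => Re (Blaschke_partial z N w))),
   real (Lim_seq (fun N => Im (Blaschke_partial z N w)))).

(* [C_derive] takes the limit of the difference quotient along the real direction;
   it is the complex derivative wherever the latter exists, hence for iterates of
   an analytic function everywhere in its open domain. *)
Fixpoint C_derive_n (f : C -> C) (n : nat) (w : C) : C :=
  match n with
  | O => f w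
  | S k => C_derive (C_derive_n f k) w
  end.

Definition circle_integral (f : C -> C) (p r : R) : R :=
  RInt (fun theta => rpow (Cmod (f (polar r theta))) p) 0 (2 * PI).

(* Main.v *)
Require Import Defs.
From Stdlib Require Import Reals Factorial Lra Lia Psatz.
From Coquelicot Require Import Coquelicot.
Open Scope R_scope.

(** Write [a_n = 1 - |z_n|^2] and [d_n = |1 - conj z_n w|]. The [j]-th Taylor
    coefficient at [w] of the [n]-th Blaschke factor is at most
    [a_n / d_n^(j+1) <= (2 (a_n / d_n^(l+1))^(1/l))^j] for [1 <= j <= l], because
    [a_n <= 2 d_n]; multiplying the factors, [B^(l)(w)] is bounded by a constant times
    [(sum_n (a_n / d_n^(l+1))^(1/l))^l], and since [l q <= 1],
    [|B^(l)(w)|^q <= C sum_n (a_n / d_n^(l+1))^q]. As [(l+1) q > 1], integration over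
    the circle of radius [x] gives [C sum_n t_n^q (1 - r_n x)^(1 - (l+1) q)] with
    [t_n = 1 - r_n], and [1 - r_n x >= max (t_n, 1 - x)]. The first monotonicity
    hypothesis when [t_n <= 1 - x], and the second one otherwise, bound each term by
    [h(t_n) (1-x)^(1 - l q) / h(1-x)]. For the little-o, finitely many terms are
    instead bounded by [1]. All estimates are made on partial products, whose Taylor
    coefficients obey an explicit recursion and converge locally uniformly, so that no
    complex function theory is required. *)

(** * Derivatives of the partial products *)

(** An [l]-th order coefficient of the product mixes several factors whose orders add up to [l].
    Bounding order [j] of the [n]-th factor by [v_n ^ j], with one number [v_n] for all [j], makes
    every mixed term homogeneous of degree [l], so that their total is at most [(sum v_n) ^ l]; this
    is why the [l]-th root of the extreme bound [a_n / d_n ^ (l+1)] is taken. Only then can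
    subadditivity separate the zeros. [C_derive], [Lim_seq] and [RInt] are total operators, so each
    use has to be backed by differentiability, convergence or integrability. All of this rests on
    one estimate: the weighted sums [sum_k |c_k| tau ^ k] of the Taylor coefficients of a partial
    product are at most [1], however many factors are present. It yields a convergence rate uniform
    on smaller discs, hence termwise differentiation and continuity on circles, and also the maximum
    of [|B^(l)|] needed when [p > q]. *)

Definition is_Cderive (f : R -> C) (x : R) (d : C) : Prop :=
  is_derive (fun t => Re (f t)) x (Re d) /\
  is_derive (fun t => Im (f t)) x (Im d).

Lemma is_Cderive_const (c : C) (x : R) : is_Cderive (fun _ => c) x 0%C.
Proof. split; apply (is_derive_const (V := R_NormedModule)). Qed.

Lemma is_Cderive_plus (f g : R -> C) (x : R) (df dg : C) :
  is_Cderive f x df -> is_Cderive g x dg ->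
  is_Cderive (fun t => f t + g t)%C x (df + dg)%C.
Proof.
intros [f1 f2] [g1 g2]; split.
- exact (is_derive_plus _ _ _ _ _ f1 g1).
- exact (is_derive_plus _ _ _ _ _ f2 g2).
Qed.

Lemma is_Cderive_eq (f : R -> C) (x : R) (d d' : C) :
  is_Cderive f x d -> d = d' -> is_Cderive f x d'.
Proof. intros H <-; exact H. Qed.

Lemma is_derive_eq (f : R -> R) (x d d' : R) :
  is_derive f x d -> d = d' -> is_derive f x d'.
Proof. intros H <-; exact H. Qed.

Lemma is_Cderive_mult (f g : R -> C) (x : R) (df dg : C) :
  is_Cderive f x df -> is_Cderive g x dg ->
  is_Cderive (fun t => f t * g t)%C x (df * g x + f x * dg)%C.
Proof.
intros [f1 f2] [g1 g2]; split.
- refine (is_derive_eq _ _ _ _ (is_derive_minus _ _ _ _ _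
    (Derive.is_derive_mult _ _ _ _ _ f1 g1)
    (Derive.is_derive_mult _ _ _ _ _ f2 g2)) _).
  unfold minus, plus, opp; simpl; unfold Re, Im; ring.
- refine (is_derive_eq _ _ _ _ (is_derive_plus _ _ _ _ _
    (Derive.is_derive_mult _ _ _ _ _ f1 g2)
    (Derive.is_derive_mult _ _ _ _ _ f2 g1)) _).
  unfold minus, plus, opp; simpl; unfold Re, Im; ring.
Qed.

Lemma C_neq_0_norm2 (c : C) : c <> 0%C -> fst c ^ 2 + snd c ^ 2 <> 0.
Proof.
intros H E; apply H; destruct c as [a b]; simpl in *.
assert (a = 0) by nra; assert (b = 0) by nra; subst; reflexivity.
Qed.

Lemma is_Cderive_inv (f : R -> C) (x : R) (df : C) :
  is_Cderive f x df -> f x <> 0%C ->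
  is_Cderive (fun t => / f t)%C x (- df * / f x * / f x)%C.
Proof.
intros [f1 f2] H; apply C_neq_0_norm2 in H.
(* [/ f t] is by definition the conjugate over the squared modulus; both components use the quotient
   rule with this common denominator. *)
assert (D : is_derive (fun t => Re (f t) ^ 2 + Im (f t) ^ 2) x
  (2 * Re (f x) * Re df + 2 * Im (f x) * Im df)).
{ refine (is_derive_eq _ _ _ _ (is_derive_plus _ _ _ _ _
    (is_derive_pow _ 2 _ _ f1) (is_derive_pow _ 2 _ _ f2)) _).
  unfold plus; simpl; ring. }
split.
- refine (is_derive_eq _ _ _ _ (is_derive_div _ _ _ _ _ f1 D H) _).
  unfold Re, Im in *; simpl in *; field; intros E; apply H; rewrite <- E; ring.
- refine (is_derive_eq _ _ _ _
    (is_derive_div _ _ _ _ _ (is_derive_opp _ _ _ f2) D H) _).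
  unfold Re, Im, opp in *; simpl in *; field; intros E; apply H; rewrite <- E; ring.
Qed.

(** The reciprocal [g] of the displacement from [w] to the pole [1 / Cconj a] of the factor: [1 -
    Cconj a * (w + t) = (1 - Cconj a * w) * (1 - g * t)]. *)
Definition Blaschke_pole (a w : C) : C := (Cconj a / (1 - Cconj a * w))%C.

Definition Blaschke_factor' (a w : C) : C :=
  (- (RtoC (Cmod a) / a) * (1 - a * Cconj a)
   / (1 - Cconj a * w) / (1 - Cconj a * w))%C.

(* If [e k] are the Taylor coefficients of [F], these are the Taylor
   coefficients of [t F(t) / (1 - g t)]. *)
Fixpoint geometric_conv (g : C) (e : nat -> C) (k : nat) : C :=
  match k with
  | O => 0%C
  | S j => (e j + g * geometric_conv g e j)%C
  end.

(* Taylor coefficients at [w] of the partial products: the factor with zero [a]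
   is [Blaschke_factor a w + Blaschke_factor' a w * t / (1 - Blaschke_pole a w * t)]
   at the point [w + t]. *)
Fixpoint taylor (z : nat -> C) (N : nat) (w : C) (k : nat) : C :=
  match N with
  | O => match k with O => 1%C | S _ => 0%C end
  | S n => (Blaschke_factor (z n) w * taylor z n w k
            + Blaschke_factor' (z n) w
              * geometric_conv (Blaschke_pole (z n) w) (taylor z n w) k)%C
  end.

Lemma taylor_0 (z : nat -> C) (N : nat) (w : C) :
  taylor z N w 0 = Blaschke_partial z N w.
Proof. induction N as [|N IH]; simpl; [|rewrite IH]; ring. Qed.

Lemma is_Cderive_ext (f g : R -> C) (x : R) (d : C) :
  (forall t, f t = g t) -> is_Cderive f x d -> is_Cderive g x d.
Proof.
intros E [f1 f2]; split; eapply is_derive_ext; try eassumption;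
 intros t; simpl; rewrite E; reflexivity.
Qed.

Lemma is_Cderive_Blaschke_inv (a : C) (w : R -> C) (x : R) (dw : C) :
  is_Cderive w x dw -> (1 - Cconj a * w x <> 0)%C ->
  is_Cderive (fun t => / (1 - Cconj a * w t))%C x
    (Cconj a * dw / (1 - Cconj a * w x) / (1 - Cconj a * w x))%C.
Proof.
intros Hw H.
assert (D : is_Cderive (fun t => 1 - Cconj a * w t)%C x (- Cconj a * dw)%C).
{ refine (is_Cderive_ext (fun t => 1 + - Cconj a * w t)%C _ _ _ _ _).
  - intros t; ring.
  - refine (is_Cderive_eq _ _ _ _ (is_Cderive_plus _ _ _ _ _ (is_Cderive_const _ _)
     (is_Cderive_mult _ _ _ _ _ (is_Cderive_const _ _) Hw)) _); ring. }
refine (is_Cderive_eq _ _ _ _ (is_Cderive_inv _ _ _ D H) _).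
unfold Cdiv; ring.
Qed.

Lemma is_Cderive_Blaschke_pole (a : C) (w : R -> C) (x : R) (dw : C) :
  is_Cderive w x dw -> (1 - Cconj a * w x <> 0)%C ->
  is_Cderive (fun t => Blaschke_pole a (w t)) x
    (Blaschke_pole a (w x) * Blaschke_pole a (w x) * dw)%C.
Proof.
intros Hw H.
refine (is_Cderive_eq _ _ _ _ (is_Cderive_mult _ _ _ _ _ (is_Cderive_const _ _)
  (is_Cderive_Blaschke_inv a w x dw Hw H)) _).
unfold Blaschke_pole, Cdiv; ring.
Qed.

Lemma is_Cderive_Blaschke_factor (a : C) (w : R -> C) (x : R) (dw : C) :
  is_Cderive w x dw -> (1 - Cconj a * w x <> 0)%C ->
  is_Cderive (fun t => Blaschke_factor a (w t)) x
    (Blaschke_factor' a (w x) * dw)%C.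
Proof.
intros Hw H.
assert (D : is_Cderive (fun t => a + (- (1)) * w t)%C x (- dw)%C).
{ refine (is_Cderive_eq _ _ _ _ (is_Cderive_plus _ _ _ _ _ (is_Cderive_const _ _)
   (is_Cderive_mult _ _ _ _ _ (is_Cderive_const _ _) Hw)) _); ring. }
refine (is_Cderive_ext _ _ _ _ _ (is_Cderive_eq _ _ _ _
  (is_Cderive_mult _ _ _ _ _ (is_Cderive_const (RtoC (Cmod a) / a) _)
  (is_Cderive_mult _ _ _ _ _ D (is_Cderive_Blaschke_inv a w x dw Hw H))) _)).
- intros t; unfold Blaschke_factor, Cdiv; ring.
- unfold Blaschke_factor'. generalize (RtoC (Cmod a) / a)%C; intros u.
  field; exact H.
Qed.

Lemma is_Cderive_Blaschke_factor' (a : C) (w : R -> C) (x : R) (dw : C) :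
  is_Cderive w x dw -> (1 - Cconj a * w x <> 0)%C ->
  is_Cderive (fun t => Blaschke_factor' a (w t)) x
    (2 * Blaschke_pole a (w x) * Blaschke_factor' a (w x) * dw)%C.
Proof.
intros Hw H.
pose proof (is_Cderive_Blaschke_inv a w x dw Hw H) as D.
refine (is_Cderive_ext _ _ _ _ _ (is_Cderive_eq _ _ _ _
  (is_Cderive_mult _ _ _ _ _
    (is_Cderive_const (- (RtoC (Cmod a) / a) * (1 - a * Cconj a))%C _)
  (is_Cderive_mult _ _ _ _ _ D D)) _)).
- intros t; unfold Blaschke_factor', Cdiv; ring.
- unfold Blaschke_factor', Blaschke_pole, Cdiv; ring.
Qed.

Definition Cnat (k : nat) : C := RtoC (INR k).

Lemma Cnat_S (k : nat) : Cnat (S k) = (Cnat k + 1)%C.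
Proof. unfold Cnat; rewrite S_INR, RtoC_plus; reflexivity. Qed.

(** Moving the centre should send the [k]-th coefficient to [k+1] times the next one. The
    convolution alone misses this by [- e k - 2 g * geometric_conv g e k], exactly what the
    derivatives of [Blaschke_factor] and [Blaschke_factor'] restore in [taylor]. *)
Lemma is_Cderive_geometric_conv (g : R -> C) (e : R -> nat -> C) (x : R) (dw : C) :
  is_Cderive g x (g x * g x * dw)%C ->
  (forall k, is_Cderive (fun t => e t k) x (Cnat (S k) * e x (S k) * dw)%C) ->
  forall k, is_Cderive (fun t => geometric_conv (g t) (e t) k) x
    ((Cnat (S k) * geometric_conv (g x) (e x) (S k) - e x k
      - 2 * g x * geometric_conv (g x) (e x) k) * dw)%C.
Proof.
intros Hg He k; induction k as [|k IH].
- refine (is_Cderive_eq _ _ _ _ (is_Cderive_const _ _) _); simpl.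
  rewrite Cnat_S; unfold Cnat; simpl; ring.
- refine (is_Cderive_eq _ _ _ _ (is_Cderive_plus _ _ _ _ _ (He k)
    (is_Cderive_mult _ _ _ _ _ Hg IH)) _).
  simpl; rewrite !Cnat_S; ring.
Qed.

(** This differential recursion is what identifies the algebraically defined [taylor z N w k] with a
    [k]-th derivative over [k!]. The path is arbitrary: horizontal lines serve [C_derive], circles
    serve continuity of the integrand. *)
Lemma is_Cderive_taylor (z : nat -> C) (w : R -> C) (x : R) (dw : C) :
  is_Cderive w x dw -> (forall n, 1 - Cconj (z n) * w x <> 0)%C ->
  forall N k, is_Cderive (fun t => taylor z N (w t) k) x
    (Cnat (S k) * taylor z N (w x) (S k) * dw)%C.
Proof.
intros Hw H N; induction N as [|N IH]; intros k.
- refine (is_Cderive_eq _ _ _ _ (is_Cderive_const _ _) _); simpl; ring.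
- refine (is_Cderive_eq _ _ _ _ (is_Cderive_plus _ _ _ _ _
    (is_Cderive_mult _ _ _ _ _ (is_Cderive_Blaschke_factor (z N) w x dw Hw (H N)) (IH k))
    (is_Cderive_mult _ _ _ _ _ (is_Cderive_Blaschke_factor' (z N) w x dw Hw (H N))
      (is_Cderive_geometric_conv (fun t => Blaschke_pole (z N) (w t))
        (fun t => taylor z N (w t)) x dw
        (is_Cderive_Blaschke_pole (z N) w x dw Hw (H N)) IH k))) _).
  simpl; rewrite !Cnat_S; ring.
Qed.

(** * Bounds on the Taylor coefficients *)

Lemma Cmod_minus_triangle (u v : C) : Cmod u - Cmod v <= Cmod (u - v)%C.
Proof.
pose proof (Cmod_triangle (u - v) v) as H.
replace (u - v + v)%C with u in H by ring; lra.
Qed.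

Lemma Cmod_Blaschke_denom (a w : C) :
  1 - Cmod a * Cmod w <= Cmod (1 - Cconj a * w)%C.
Proof.
pose proof (Cmod_minus_triangle 1 (Cconj a * w)) as H.
rewrite Cmod_mult, Cmod_conj, Cmod_1 in H; exact H.
Qed.

(** The identity behind the Schwarz-Pick lemma; divided by the right-hand side, it gives the exact
    defect [1 - |b| ^ 2] of a factor. *)
Lemma Blaschke_identity (a w : C) :
  Cmod (a - w)%C ^ 2 + (1 - Cmod a ^ 2) * (1 - Cmod w ^ 2)
  = Cmod (1 - Cconj a * w)%C ^ 2.
Proof. rewrite !Cmod2_alt; destruct a, w; simpl; unfold Re, Im; simpl; ring. Qed.

(** * Estimates for a single factor on a disc of radius [1 - delta] *)

Section OneFactor.

Variables (a w : C) (delta : R).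
Hypothesis (ha0 : a <> 0%C) (ha1 : Cmod a < 1) (hdelta : 0 < delta)
  (hw : Cmod w <= 1 - delta).

Let d := Cmod (1 - Cconj a * w)%C.

Lemma Cmod_a_gt0 : 0 < Cmod a.
Proof. apply Cmod_gt_0; exact ha0. Qed.

Lemma denom_ge_delta : delta <= d.
Proof.
pose proof (Cmod_Blaschke_denom a w); pose proof Cmod_a_gt0.
pose proof (Cmod_ge_0 w); unfold d; nra.
Qed.

Lemma denom_ge_a : 1 - Cmod a <= d.
Proof.
pose proof (Cmod_Blaschke_denom a w); pose proof Cmod_a_gt0.
pose proof (Cmod_ge_0 w); unfold d; nra.
Qed.

Lemma denom_neq0 : (1 - Cconj a * w <> 0)%C.
Proof.
apply Cmod_gt_0; pose proof denom_ge_delta; unfold d in *; lra.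
Qed.

Lemma Cmod_Blaschke_pole : Cmod (Blaschke_pole a w) <= / d.
Proof.
unfold Blaschke_pole; rewrite Cmod_div by exact denom_neq0.
rewrite Cmod_conj; fold d; pose proof denom_ge_delta.
unfold Rdiv; rewrite <- (Rmult_1_l (/ d)) at 2.
apply Rmult_le_compat_r; [apply Rlt_le, Rinv_0_lt_compat|]; lra.
Qed.

Lemma Cmod_unimodular : Cmod (RtoC (Cmod a) / a)%C = 1.
Proof.
rewrite Cmod_div by exact ha0; rewrite Cmod_R.
pose proof Cmod_a_gt0; rewrite Rabs_pos_eq by lra; field; lra.
Qed.

Lemma Cmod_Blaschke_factor' : Cmod (Blaschke_factor' a w) = (1 - Cmod a ^ 2) / d ^ 2.
Proof.
unfold Blaschke_factor'; pose proof denom_neq0 as H.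
rewrite !Cmod_div, Cmod_mult, Cmod_opp, Cmod_unimodular by exact H.
rewrite <- Cmod2_conj, <- RtoC_minus, Cmod_R.
pose proof Cmod_a_gt0; rewrite Rabs_pos_eq by nra.
fold d; pose proof denom_ge_delta; field; lra.
Qed.

Lemma Cmod_Blaschke_factor :
  Cmod (Blaschke_factor a w) ^ 2 = 1 - (1 - Cmod a ^ 2) * (1 - Cmod w ^ 2) / d ^ 2.
Proof.
unfold Blaschke_factor.
rewrite Cmod_mult, Cmod_unimodular, Rmult_1_l, Cmod_div by exact denom_neq0.
unfold Rdiv; rewrite Rpow_mult_distr, pow_inv; fold d.
pose proof (Blaschke_identity a w) as E; fold d in E.
pose proof denom_ge_delta.
replace (Cmod (a - w)%C ^ 2) with (d ^ 2 - (1 - Cmod a ^ 2) * (1 - Cmod w ^ 2)) by lra.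
field; lra.
Qed.

(** Equality in Schwarz-Pick: with [b] the factor and [b'] its derivative, [1 - |b| ^ 2 = |b'| * (1
    - |w| ^ 2) >= delta * |b'|], while [1 - |b| ^ 2 <= 2 * (1 - |b|)]. *)
Lemma Blaschke_factor_drop :
  Cmod (Blaschke_factor a w) + delta / 2 * Cmod (Blaschke_factor' a w) <= 1.
Proof.
pose proof Cmod_Blaschke_factor as E; rewrite Cmod_Blaschke_factor'.
pose proof (Cmod_ge_0 (Blaschke_factor a w)).
pose proof denom_ge_delta; pose proof Cmod_a_gt0; pose proof (Cmod_ge_0 w).
set (t := (1 - Cmod a ^ 2) / d ^ 2) in *.
assert (0 <= t).
{ apply Rmult_le_pos; [nra|]; apply Rlt_le, Rinv_0_lt_compat; nra. }
replace ((1 - Cmod a ^ 2) * (1 - Cmod w ^ 2) / d ^ 2)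
  with (t * (1 - Cmod w ^ 2)) in E by (unfold t; field; lra).
set (b := Cmod (Blaschke_factor a w)) in *.
assert (delta <= 1 - Cmod w ^ 2) by nra.
assert (b ^ 2 <= 1 - t * delta) by nra.
nra.
Qed.

Lemma Cmod_Blaschke_factor_le1 : Cmod (Blaschke_factor a w) <= 1.
Proof.
pose proof Blaschke_factor_drop; pose proof (Cmod_ge_0 (Blaschke_factor' a w)); nra.
Qed.

Lemma Cmod_Blaschke_factor'_le :
  Cmod (Blaschke_factor' a w) <= 2 / delta ^ 2 * (1 - Cmod a).
Proof.
rewrite Cmod_Blaschke_factor'; pose proof denom_ge_delta; pose proof Cmod_a_gt0.
apply Rle_trans with (2 * (1 - Cmod a) / delta ^ 2); [|right; field; lra].
apply Rmult_le_compat; [nra| |nra|].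
- apply Rlt_le, Rinv_0_lt_compat; nra.
- apply Rinv_le_contravar; nra.
Qed.

(** The normalisation [|a| / a] makes the factor close to [1]: since [Cconj a = |a| ^ 2 / a], the
    numerator of the difference factors as [(|a| - 1) * (1 + |a| / a * w)]. The factor [1 - |a|] is
    the summable one. *)
Lemma Cmod_Blaschke_factor_minus1 :
  Cmod (Blaschke_factor a w - 1)%C <= 2 / delta ^ 2 * (1 - Cmod a).
Proof.
pose proof denom_ge_delta; pose proof Cmod_a_gt0; pose proof (Cmod_ge_0 w).
assert (E : (Blaschke_factor a w - 1
  = (RtoC (Cmod a) - 1) * (1 + RtoC (Cmod a) / a * w) / (1 - Cconj a * w))%C).
{ unfold Blaschke_factor.
  pose proof (Cmod2_conj a) as Ea.
  assert (Eb : (Cconj a = RtoC (Cmod a) * RtoC (Cmod a) / a)%C).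
  { rewrite <- RtoC_mult. replace (Cmod a * Cmod a) with (Cmod a ^ 2) by ring.
    rewrite Ea; field; exact ha0. }
  pose proof denom_neq0 as H'; rewrite Eb in H' |- *.
  field; repeat split; try exact ha0.
  intros E; apply H'.
  replace (1 - RtoC (Cmod a) * RtoC (Cmod a) / a * w)%C
    with ((a - RtoC (Cmod a) * RtoC (Cmod a) * w) / a)%C by (field; exact ha0).
  rewrite E; field; exact ha0. }
rewrite E, Cmod_div by exact denom_neq0; fold d.
rewrite Cmod_mult, <- RtoC_minus, Cmod_R, Rabs_left1 by lra.
assert (Cmod (1 + RtoC (Cmod a) / a * w)%C <= 2).
{ eapply Rle_trans; [apply Cmod_triangle|].
  rewrite Cmod_mult, Cmod_unimodular, Cmod_1; lra. }
assert (/ d <= / delta) by (apply Rinv_le_contravar; lra).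
(* Here [delta <= 1], because [0 <= Cmod w <= 1 - delta]. *)
assert (/ delta <= / delta ^ 2) by (apply Rinv_le_contravar; nra).
assert (0 < / d) by (apply Rinv_0_lt_compat; lra).
apply Rle_trans with ((1 - Cmod a) * 2 * / delta ^ 2); [|right; field; lra].
unfold Rdiv; apply Rmult_le_compat; [|lra| |lra].
- apply Rmult_le_pos; [lra|apply Cmod_ge_0].
- apply Rmult_le_compat; try lra; apply Cmod_ge_0.
Qed.

End OneFactor.

Fixpoint partial_sum (f : nat -> R) (N : nat) : R :=
  match N with
  | O => 0
  | S n => partial_sum f n + f n
  end.

Lemma partial_sum_ge0 (f : nat -> R) (N : nat) :
  (forall n, 0 <= f n) -> 0 <= partial_sum f N.
Proof.
intros H; induction N as [|N IH]; simpl; [lra|]; pose proof (H N); lra.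
Qed.

Lemma partial_sum_le (f g : nat -> R) (N : nat) :
  (forall n, f n <= g n) -> partial_sum f N <= partial_sum g N.
Proof.
intros H; induction N as [|N IH]; simpl; [lra|]; pose proof (H N); lra.
Qed.

Lemma partial_sum_scal (c : R) (f : nat -> R) (N : nat) :
  partial_sum (fun n => c * f n) N = c * partial_sum f N.
Proof. induction N as [|N IH]; simpl; [|rewrite IH]; ring. Qed.

(** Summing the recursion gives [SQ (S n) <= tau * SE n + |g| * tau * SQ n]. As [|g| * tau <= 1/3],
    this closes with the geometric factor [1 / (1 - 1/3) = 3/2]. Truncated sums avoid any question
    of convergence in [k]. *)
Lemma geometric_conv_sum (g : C) (e : nat -> C) (tau : R) (K : nat) :
  0 <= tau -> Cmod g * tau <= 1 / 3 ->
  sum_f_R0 (fun k => Cmod (geometric_conv g e k) * tau ^ k) K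
  <= 3 / 2 * tau * sum_f_R0 (fun k => Cmod (e k) * tau ^ k) K.
Proof.
intros Ht Hg.
set (SQ := sum_f_R0 (fun k => Cmod (geometric_conv g e k) * tau ^ k)).
set (SE := sum_f_R0 (fun k => Cmod (e k) * tau ^ k)).
assert (Hpos : forall k, 0 <= Cmod (e k) * tau ^ k).
{ intros k; apply Rmult_le_pos; [apply Cmod_ge_0|apply pow_le; exact Ht]. }
assert (HSE : forall n, 0 <= SE n).
{ intros n; apply cond_pos_sum; exact Hpos. }
assert (HSQ : forall n, 0 <= SQ n).
{ intros n; apply cond_pos_sum; intros k.
  apply Rmult_le_pos; [apply Cmod_ge_0|apply pow_le; exact Ht]. }
assert (Q0 : SQ 0%nat = 0).
{ unfold SQ; simpl; rewrite Cmod_0; ring. }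
assert (step : forall n, SQ (S n) <= tau * SE n + Cmod g * tau * SQ n).
{ assert (term : forall n, Cmod (geometric_conv g e (S n)) * tau ^ S n
    <= tau * (Cmod (e n) * tau ^ n)
       + Cmod g * tau * (Cmod (geometric_conv g e n) * tau ^ n)).
  { intros n; simpl.
    pose proof (Cmod_triangle (e n) (g * geometric_conv g e n)) as T.
    rewrite Cmod_mult in T.
    apply Rmult_le_compat_r with (r := tau * tau ^ n) in T; [lra|].
    apply Rmult_le_pos; [exact Ht|apply pow_le; exact Ht]. }
  intros n; induction n as [|n IH].
  - pose proof (term 0%nat) as T; unfold SQ, SE in *; simpl in *.
    rewrite Cmod_0 in *; lra.
  - change (SQ (S (S n))) with (SQ (S n)
      + Cmod (geometric_conv g e (S (S n))) * tau ^ (S (S n))).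
    change (SE (S n)) with (SE n + Cmod (e (S n)) * tau ^ (S n)).
    change (SQ (S n)) with (SQ n + Cmod (geometric_conv g e (S n)) * tau ^ (S n)) at 2.
    pose proof (term (S n)); lra. }
induction K as [|K IH].
- rewrite Q0; pose proof (HSE 0%nat); nra.
- eapply Rle_trans; [apply step|].
  assert (SE K <= SE (S K)).
  { change (SE (S K)) with (SE K + Cmod (e (S K)) * tau ^ (S K)).
    pose proof (Hpos (S K)); lra. }
  pose proof (HSE K); pose proof (HSQ K).
  apply Rle_trans with (tau * SE K + 1 / 3 * SQ K); nra.
Qed.

(** * Partial products on a disc of radius [1 - delta] *)

Section Zeros.

Variables (z : nat -> C) (w : C) (delta : R).
Hypothesis (hz : forall n, z n <> 0%C /\ Cmod (z n) < 1) (hdelta : 0 < delta)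
  (hw : Cmod w <= 1 - delta).

(** The divisor [3] serves twice: [|g| <= 1 / delta] gives [|g| * tau <= 1/3], and then
    [3/2 * tau = delta / 2] is the coefficient in [Blaschke_factor_drop]. *)
Let tau := delta / 3.

(* Each factor [b] satisfies [|b| + sum_{j >= 1} |b_j| tau ^ j <= 1]: the Taylor
   coefficients [b_j] are paid for by [1 - |b| ^ 2]. This replaces Cauchy's estimate. *)
Lemma taylor_sum_le1 (N K : nat) :
  sum_f_R0 (fun k => Cmod (taylor z N w k) * tau ^ k) K <= 1.
Proof.
assert (Ht : 0 < tau) by (unfold tau; lra).
induction N as [|N IH].
- right; simpl; induction K as [|K IH]; simpl.
  + rewrite Cmod_1; ring.
  + rewrite IH, Cmod_0; ring.
- destruct (hz N) as [h0 h1].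
  set (b := Cmod (Blaschke_factor (z N) w)).
  set (b' := Cmod (Blaschke_factor' (z N) w)).
  pose proof (Blaschke_factor_drop (z N) w delta h0 h1 hdelta hw) as drop.
  fold b b' in drop.
  assert (Hb : 0 <= b) by apply Cmod_ge_0.
  assert (Hb' : 0 <= b') by apply Cmod_ge_0.
  set (e := taylor z N w) in *; set (g := Blaschke_pole (z N) w).
  assert (Hg : Cmod g * tau <= 1 / 3).
  { pose proof (Cmod_Blaschke_pole (z N) w delta h0 h1 hdelta hw) as G; fold g in G.
    pose proof (denom_ge_delta (z N) w delta h0 h1 hw) as D.
    assert (I : Cmod g <= / delta).
    { eapply Rle_trans; [exact G|]; apply Rinv_le_contravar; [exact hdelta|exact D]. }
    unfold tau; apply Rle_trans with (/ delta * (delta / 3)).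
    - apply Rmult_le_compat_r; lra.
    - right; field; lra. }
  pose proof (geometric_conv_sum g e tau K (Rlt_le _ _ Ht) Hg) as Q.
  apply Rle_trans with
    (b * sum_f_R0 (fun k => Cmod (e k) * tau ^ k) K
     + b' * sum_f_R0 (fun k => Cmod (geometric_conv g e k) * tau ^ k) K).
  + rewrite !scal_sum, <- sum_plus; apply sum_Rle; intros k _.
    simpl; fold e g.
    pose proof (Cmod_triangle (Blaschke_factor (z N) w * e k)
      (Blaschke_factor' (z N) w * geometric_conv g e k)) as T.
    rewrite !Cmod_mult in T; fold b b' in T.
    apply Rmult_le_compat_r with (r := tau ^ k) in T; [|apply pow_le; lra]; lra.
  + set (SE := sum_f_R0 (fun k => Cmod (e k) * tau ^ k) K) in *.
    assert (0 <= SE).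
    { apply cond_pos_sum; intros k.
      apply Rmult_le_pos; [apply Cmod_ge_0|apply pow_le; lra]. }
    apply Rle_trans with ((b + delta / 2 * b') * SE).
    * unfold tau in *; nra.
    * nra.
Qed.

Lemma sum_term_le (f : nat -> R) (K : nat) :
  (forall k, 0 <= f k) -> f K <= sum_f_R0 f K.
Proof.
intros H; destruct K as [|K]; [simpl; lra|].
simpl; pose proof (cond_pos_sum f K H); lra.
Qed.

Lemma Cmod_taylor_le (N k : nat) : Cmod (taylor z N w k) <= / tau ^ k.
Proof.
assert (Ht : 0 < tau ^ k) by (apply pow_lt; unfold tau; lra).
apply Rmult_le_reg_r with (tau ^ k); [exact Ht|].
rewrite Rinv_l by lra; eapply Rle_trans; [|apply (taylor_sum_le1 N k)].
apply (sum_term_le (fun k => Cmod (taylor z N w k) * tau ^ k)).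
intros j; apply Rmult_le_pos; [apply Cmod_ge_0|apply pow_le; unfold tau; lra].
Qed.

Lemma Cmod_taylor_conv_le (N k : nat) :
  Cmod (geometric_conv (Blaschke_pole (z N) w) (taylor z N w) k) <= / tau ^ k.
Proof.
assert (Ht0 : 0 < tau) by (unfold tau; lra).
assert (Ht : 0 < tau ^ k) by (apply pow_lt; exact Ht0).
apply Rmult_le_reg_r with (tau ^ k); [exact Ht|].
rewrite Rinv_l by lra; destruct (hz N) as [h0 h1].
set (e := taylor z N w); set (g := Blaschke_pole (z N) w).
eapply Rle_trans; [apply (sum_term_le (fun k => Cmod (geometric_conv g e k) * tau ^ k))|].
- intros j; apply Rmult_le_pos; [apply Cmod_ge_0|apply pow_le; lra].
- eapply Rle_trans; [apply geometric_conv_sum; [lra|]|].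
  + pose proof (Cmod_Blaschke_pole (z N) w delta h0 h1 hdelta hw) as G; fold g in G.
    pose proof (denom_ge_delta (z N) w delta h0 h1 hw) as D.
    assert (I : Cmod g <= / delta).
    { eapply Rle_trans; [exact G|]; apply Rinv_le_contravar; [exact hdelta|exact D]. }
    unfold tau; apply Rle_trans with (/ delta * (delta / 3)).
    * apply Rmult_le_compat_r; lra.
    * right; field; lra.
  + pose proof (taylor_sum_le1 N k) as S1; fold e in S1.
    pose proof (Cmod_ge_0 w).
    assert (tau <= 1 / 3) by (unfold tau; lra).
    set (SE := sum_f_R0 (fun k => Cmod (e k) * tau ^ k) k) in *.
    assert (3 / 2 * tau * SE <= 3 / 2 * tau * 1) by (apply Rmult_le_compat_l; lra).
    lra.
Qed.

(** One more factor changes a coefficient by [(b - 1) * e k] plus [b'] times a convolution. Both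
    [b - 1] and [b'] are [O(1 - |z_N|)], and the other quantities are bounded independently of [N];
    each part contributes [2] to the constant [4]. *)
Lemma taylor_increment (N k : nat) :
  Cmod (taylor z (S N) w k - taylor z N w k)%C
  <= 4 / delta ^ 2 / tau ^ k * (1 - Cmod (z N)).
Proof.
destruct (hz N) as [h0 h1].
set (e := taylor z N w); set (g := Blaschke_pole (z N) w).
replace (taylor z (S N) w k - e k)%C
  with ((Blaschke_factor (z N) w - 1) * e k
        + Blaschke_factor' (z N) w * geometric_conv g e k)%C
  by (simpl; fold e g; ring).
eapply Rle_trans; [apply Cmod_triangle|]; rewrite !Cmod_mult.
assert (Ht : 0 < tau ^ k) by (apply pow_lt; unfold tau; lra).
replace (4 / delta ^ 2 / tau ^ k * (1 - Cmod (z N)))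
  with (2 / delta ^ 2 * (1 - Cmod (z N)) * / tau ^ k
        + 2 / delta ^ 2 * (1 - Cmod (z N)) * / tau ^ k)
  by (field; split; lra).
apply Rplus_le_compat; apply Rmult_le_compat; try apply Cmod_ge_0.
- exact (Cmod_Blaschke_factor_minus1 (z N) w delta h0 h1 hdelta hw).
- exact (Cmod_taylor_le N k).
- exact (Cmod_Blaschke_factor'_le (z N) w delta h0 h1 hdelta hw).
- exact (Cmod_taylor_conv_le N k).
Qed.

(** Beyond its constant term, of modulus at most [1], each factor is dominated by the geometric
    series of [v n * t]. The product of these series has as coefficients the complete homogeneous
    polynomials in the [v n], at most the powers of their sum. *)
Lemma taylor_majorant (v : nat -> R) (l : nat) :
  (forall n, 0 <= v n) ->
  (forall n i, (i < l)%nat ->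
    Cmod (Blaschke_factor' (z n) w) * Cmod (Blaschke_pole (z n) w) ^ i
    <= v n ^ S i) ->
  forall N k, (k <= l)%nat ->
    Cmod (taylor z N w k) <= partial_sum v N ^ k.
Proof.
intros Hv Hb N; induction N as [|N IH]; intros k Hk.
- simpl; destruct k; simpl; [rewrite Cmod_1|rewrite Cmod_0]; lra.
- destruct (hz N) as [h0 h1].
  set (e := taylor z N w) in *; set (g := Blaschke_pole (z N) w) in *.
  set (b' := Blaschke_factor' (z N) w) in *.
  set (V := partial_sum v N) in *.
  assert (HV : 0 <= V) by (apply partial_sum_ge0; intros; apply Hv).
  pose proof (Hv N) as Hn.
  (* Unfolding [geometric_conv] trades one unit of [j] for a factor [g], and only the joint product
     [|b'| * |g| ^ i] is controlled; hence the induction on [j] for all [i]. Taking [i = 0] gives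
     the telescoping bound [(V + v N) ^ k - V ^ k]. *)
  assert (claim : forall j i, (i + j <= l)%nat ->
    Cmod b' * Cmod g ^ i * Cmod (geometric_conv g e j)
    <= v N ^ i * ((V + v N) ^ j - V ^ j)).
  { intros j; induction j as [|j IHj]; intros i Hi.
    - simpl; rewrite Cmod_0; lra.
    - assert (Hbi := Hb N i ltac:(lia)); fold b' g in Hbi.
      assert (IHi := IHj (S i) ltac:(lia)).
      assert (Hej := IH j ltac:(lia)).
      pose proof (Cmod_triangle (e j) (g * geometric_conv g e j)) as T.
      rewrite Cmod_mult in T.
      assert (P1 : 0 <= Cmod b' * Cmod g ^ i).
      { apply Rmult_le_pos; [|apply pow_le]; apply Cmod_ge_0. }
      apply Rle_trans with (v N ^ S i * V ^ j + v N ^ S i * ((V + v N) ^ j - V ^ j)).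
      + simpl geometric_conv.
        apply Rle_trans with (Cmod b' * Cmod g ^ i * Cmod (e j)
          + Cmod b' * Cmod g ^ S i * Cmod (geometric_conv g e j)).
        * apply Rle_trans with
            (Cmod b' * Cmod g ^ i * (Cmod (e j) + Cmod g * Cmod (geometric_conv g e j))).
          -- apply Rmult_le_compat_l; assumption.
          -- right; simpl; ring.
        * apply Rplus_le_compat; [|exact IHi].
          apply Rmult_le_compat; try assumption; apply Cmod_ge_0.
      + assert (0 <= v N ^ i) by (apply pow_le; exact Hn).
        assert (V ^ j <= (V + v N) ^ j) by (apply pow_incr; lra).
        apply Rle_trans with (v N ^ i * (v N * (V + v N) ^ j)).
        * right; simpl; ring.
        * apply Rmult_le_compat_l; [assumption|]; simpl; nra. }
  pose proof (claim k 0%nat ltac:(lia)) as Q; simpl pow in Q.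
  simpl taylor; fold e g b'; simpl partial_sum; fold V.
  eapply Rle_trans; [apply Cmod_triangle|]; rewrite !Cmod_mult.
  pose proof (Cmod_Blaschke_factor_le1 (z N) w delta h0 h1 hdelta hw).
  pose proof (IH k Hk); pose proof (Cmod_ge_0 (e k)).
  pose proof (Cmod_ge_0 (Blaschke_factor (z N) w)); nra.
Qed.

End Zeros.

(** * Powers and the pointwise estimate *)

Lemma Rpower_gt0 (x p : R) : 0 < Rpower x p.
Proof. apply exp_pos. Qed.

Lemma rpow_pos (x p : R) : 0 < x -> rpow x p = Rpower x p.
Proof. intros H; unfold rpow; destruct (Rlt_dec 0 x); [reflexivity|contradiction]. Qed.

Lemma rpow_nonpos (x p : R) : x <= 0 -> rpow x p = 0.
Proof. intros H; unfold rpow; destruct (Rlt_dec 0 x); [lra|reflexivity]. Qed.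

Lemma rpow_ge0 (x p : R) : 0 <= rpow x p.
Proof.
unfold rpow; destruct (Rlt_dec 0 x); [apply Rlt_le, Rpower_gt0|lra].
Qed.

Lemma rpow_le_compat (x y p : R) : 0 <= p -> x <= y -> rpow x p <= rpow y p.
Proof.
intros Hp Hxy; destruct (Rlt_dec 0 x) as [Hx|Hx].
- rewrite !rpow_pos by lra; apply Rle_Rpower_l; lra.
- rewrite (rpow_nonpos x) by lra; apply rpow_ge0.
Qed.

Lemma rpow_mult (x y p : R) : 0 <= x -> 0 <= y -> rpow (x * y) p = rpow x p * rpow y p.
Proof.
intros Hx Hy; destruct (Req_dec x 0) as [->|Hx0].
{ rewrite Rmult_0_l, rpow_nonpos by lra; ring. }
destruct (Req_dec y 0) as [->|Hy0].
{ rewrite Rmult_0_r, rpow_nonpos by lra; ring. }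
rewrite !rpow_pos by nra; symmetry; apply Rpower_mult_distr; lra.
Qed.

Lemma rpow_pow (x p : R) (l : nat) : 0 <= x -> (1 <= l)%nat -> rpow (x ^ l) p = rpow x (INR l * p).
Proof.
intros Hx Hl; destruct (Req_dec x 0) as [->|Hx0].
- rewrite pow_i by lia; rewrite !rpow_nonpos by lra; reflexivity.
- rewrite !rpow_pos by (try apply pow_lt; lra).
  rewrite <- Rpower_pow, Rpower_mult by lra; reflexivity.
Qed.

Lemma Rpower_le1_ge_id (s p : R) : 0 < s <= 1 -> p <= 1 -> s <= Rpower s p.
Proof.
intros Hs Hp.
assert (ln s <= 0) by (rewrite <- ln_1; apply ln_le; lra).
rewrite <- (exp_ln s) at 1 by lra; unfold Rpower.
destruct (Req_dec (ln s) (p * ln s)) as [E|E]; [rewrite <- E; lra|].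
apply Rlt_le, exp_increasing; nra.
Qed.

(** The fractions [x / (x + y)] and [y / (x + y)] lie in [(0, 1]], so their [p]-th powers dominate
    them, and they add up to [1]. *)
Lemma rpow_subadditive (x y p : R) :
  0 <= x -> 0 <= y -> p <= 1 -> rpow (x + y) p <= rpow x p + rpow y p.
Proof.
intros Hx Hy Hp; destruct (Req_dec x 0) as [->|Hx0].
{ rewrite Rplus_0_l; pose proof (rpow_ge0 0 p); lra. }
destruct (Req_dec y 0) as [->|Hy0].
{ rewrite Rplus_0_r; pose proof (rpow_ge0 0 p); lra. }
rewrite !rpow_pos by lra.
assert (Hs : forall u, 0 < u <= x + y -> Rpower (x + y) p * (u / (x + y)) <= Rpower u p).
{ intros u Hu.
  assert (H1 : 0 < u / (x + y)) by (apply Rdiv_lt_0_compat; lra).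
  assert (H2 : u / (x + y) <= 1).
  { apply Rmult_le_reg_r with (x + y); [lra|].
    unfold Rdiv; rewrite Rmult_assoc, Rinv_l; lra. }
  replace (Rpower u p) with (Rpower (x + y) p * Rpower (u / (x + y)) p).
  - apply Rmult_le_compat_l; [apply Rlt_le, Rpower_gt0|].
    apply Rpower_le1_ge_id; lra.
  - rewrite Rpower_mult_distr by lra; f_equal; field; lra. }
pose proof (Hs x ltac:(lra)) as S1; pose proof (Hs y ltac:(lra)) as S2.
replace (Rpower (x + y) p) with
  (Rpower (x + y) p * (x / (x + y)) + Rpower (x + y) p * (y / (x + y)))
  by (field; lra).
lra.
Qed.

Lemma rpow_partial_sum (v : nat -> R) (p : R) (N : nat) :
  (forall n, 0 <= v n) -> p <= 1 ->
  rpow (partial_sum v N) p <= partial_sum (fun n => rpow (v n) p) N.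
Proof.
intros Hv Hp; induction N as [|N IH]; simpl.
- rewrite rpow_nonpos; lra.
- eapply Rle_trans; [apply rpow_subadditive; try assumption|].
  + apply partial_sum_ge0; exact Hv.
  + apply Hv.
  + lra.
Qed.

Lemma Rpower_le_self (c p : R) : 1 <= c -> p <= 1 -> Rpower c p <= c.
Proof.
intros Hc Hp; rewrite <- (Rpower_1 c) at 2 by lra; apply Rle_Rpower; lra.
Qed.

(** With [y] the root and [t = y * d], one has [t ^ l = a / d], and the claim becomes
    [a / d <= (2 * t) ^ j]. For [t <= 1], [t ^ l <= t ^ j]; for [t > 1], already [a / d <= 2]
    suffices. *)
Lemma root_power_bound (a d : R) (l j : nat) :
  0 < a -> 0 < d -> a <= 2 * d -> (1 <= j <= l)%nat ->
  a / d ^ S j <= (2 * Rpower (a / d ^ S l) (/ INR l)) ^ j.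
Proof.
intros Ha Hd Had Hj.
assert (Hdl : forall i, 0 < d ^ i) by (intros; apply pow_lt; exact Hd).
assert (Hl : 0 < INR l) by (apply lt_0_INR; lia).
set (y := Rpower (a / d ^ S l) (/ INR l)).
assert (Hy : 0 < y) by apply Rpower_gt0.
assert (Hyl : y ^ l = a / d ^ S l).
{ rewrite <- Rpower_pow by exact Hy; unfold y; rewrite Rpower_mult.
  rewrite Rinv_l by lra; apply Rpower_1; apply Rdiv_lt_0_compat; auto. }
set (t := y * d).
assert (Ht : 0 < t) by (apply Rmult_lt_0_compat; assumption).
assert (Htl : t ^ l = a / d).
{ unfold t; rewrite Rpow_mult_distr, Hyl; simpl; pose proof (Hdl l); field; lra. }
assert (key : a / d <= 2 ^ j * t ^ j).
{ assert (H2 : 2 <= 2 ^ j).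
  { replace 2 with (2 ^ 1) at 1 by ring; apply Rle_pow; [lra|lia]. }
  assert (0 < t ^ j) by (apply pow_lt; exact Ht).
  destruct (Rle_dec t 1) as [H1|H1].
  - rewrite <- Htl. apply Rle_trans with (t ^ j); [|nra].
    replace l with (j + (l - j))%nat by lia; rewrite pow_add.
    assert (t ^ (l - j) <= 1).
    { rewrite <- (pow1 (l - j)); apply pow_incr; lra. }
    nra.
  - assert (1 <= t ^ j) by (apply pow_R1_Rle; lra).
    apply Rle_trans with 2; [|nra].
    apply Rmult_le_reg_r with d; [exact Hd|].
    unfold Rdiv; rewrite Rmult_assoc, Rinv_l; lra. }
rewrite Rpow_mult_distr; apply Rmult_le_reg_r with (d ^ j); [auto|].
rewrite Rmult_assoc, <- Rpow_mult_distr; fold t.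
replace (a / d ^ S j * d ^ j) with (a / d); [exact key|].
simpl; pose proof (Hdl j); field; lra.
Qed.

(* The exponent [q <= 1/l] makes both [t ^ (l q)] and [t ^ q] subadditive. *)
Lemma rpow_taylor_le (z : nat -> C) (w : C) (delta q : R) (l N : nat) :
  (forall n, z n <> 0%C /\ Cmod (z n) < 1) -> 0 < delta -> Cmod w <= 1 - delta ->
  (1 <= l)%nat -> 0 < q -> INR l * q <= 1 ->
  rpow (Cmod (taylor z N w l)) q
  <= 4 * partial_sum (fun n => Rpower (1 - Cmod (z n)) q
       * Rpower (Cmod (1 - Cconj (z n) * w)%C) (- ((INR l + 1) * q))) N.
Proof.
intros hz hdelta hw Hl Hq Hlq.
assert (Hl0 : 1 <= INR l) by (change 1 with (INR 1); apply le_INR; exact Hl).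
set (d := fun n => Cmod (1 - Cconj (z n) * w)%C).
set (a := fun n => 1 - Cmod (z n) ^ 2).
set (v := fun n => 2 * Rpower (a n / d n ^ S l) (/ INR l)).
assert (Hc : forall n, 0 < Cmod (z n)) by (intros n; apply Cmod_gt_0, hz).
assert (Ha : forall n, 0 < a n).
{ intros n; unfold a; pose proof (Hc n); destruct (hz n); nra. }
assert (Hd : forall n, 0 < d n).
{ intros n; destruct (hz n) as [h0 h1].
  pose proof (denom_ge_delta (z n) w delta h0 h1 hw); unfold d; lra. }
assert (Ha2 : forall n, a n <= 2 * (1 - Cmod (z n))).
{ intros n; unfold a; pose proof (Hc n); destruct (hz n); nra. }
assert (Had : forall n, a n <= 2 * d n).
{ intros n; destruct (hz n) as [h0 h1]; pose proof (Ha2 n).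
  pose proof (denom_ge_a (z n) w delta h0 hdelta hw); unfold d; lra. }
assert (Hv : forall n, 0 <= v n).
{ intros n; unfold v; pose proof (Rpower_gt0 (a n / d n ^ S l) (/ INR l)); lra. }
assert (Hmaj : forall n i, (i < l)%nat ->
  Cmod (Blaschke_factor' (z n) w) * Cmod (Blaschke_pole (z n) w) ^ i <= v n ^ S i).
{ intros n i Hi; destruct (hz n) as [h0 h1].
  eapply Rle_trans; [|apply (root_power_bound (a n) (d n) l (S i)); auto; lia].
  rewrite (Cmod_Blaschke_factor' (z n) w delta h0 h1 hdelta hw).
  pose proof (Cmod_Blaschke_pole (z n) w delta h0 h1 hdelta hw) as P.
  fold (d n) in P |- *; fold (a n).
  pose proof (Hd n); pose proof (Ha n).
  apply Rle_trans with (a n / d n ^ 2 * (/ d n) ^ i).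
  - apply Rmult_le_compat_l.
    + apply Rlt_le, Rdiv_lt_0_compat; [assumption|apply pow_lt; assumption].
    + apply pow_incr; split; [apply Cmod_ge_0|exact P].
  - right; rewrite pow_inv; simpl.
    assert (0 < d n ^ i) by (apply pow_lt; assumption); field; lra. }
pose proof (taylor_majorant z w delta hz hdelta hw v l Hv Hmaj N l (le_n l)) as M.
apply (rpow_le_compat _ _ q) in M; [|lra].
eapply Rle_trans; [exact M|].
rewrite rpow_pow by (try apply partial_sum_ge0; assumption).
eapply Rle_trans; [apply rpow_partial_sum; assumption|].
rewrite <- partial_sum_scal; apply partial_sum_le; intros n; unfold v.
pose proof (Rpower_gt0 (a n / d n ^ S l) (/ INR l)) as G.
rewrite rpow_pos by lra.
rewrite <- Rpower_mult_distr, Rpower_mult by lra.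
replace (/ INR l * (INR l * q)) with q by (field; lra).
fold (d n); pose proof (Hd n); pose proof (Ha n).
assert (E : Rpower (a n / d n ^ S l) q
  = Rpower (a n) q * Rpower (d n) (- ((INR l + 1) * q))).
{ unfold Rdiv; rewrite <- Rpower_mult_distr; [|assumption|].
  - f_equal; rewrite <- Rpower_pow, <- Rpower_Ropp, Rpower_mult by assumption.
    rewrite S_INR; f_equal; ring.
  - apply Rinv_0_lt_compat, pow_lt; assumption. }
rewrite E.
(* The constant [4] is [2 * 2]: one factor from [1 - |z_n| ^ 2 <= 2 * (1 - |z_n|)] with [q <= 1],
   the other from the [2] in [v], raised to [l * q <= 1]. *)
assert (A : Rpower (a n) q <= 2 * Rpower (1 - Cmod (z n)) q).
{ destruct (hz n).
  apply Rle_trans with (Rpower (2 * (1 - Cmod (z n))) q).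
  - apply Rle_Rpower_l; auto; lra.
  - rewrite <- Rpower_mult_distr by lra.
    apply Rmult_le_compat_r; [apply Rlt_le, Rpower_gt0|].
    apply Rpower_le_self; nra. }
assert (B : Rpower 2 (INR l * q) <= 2) by (apply Rpower_le_self; lra).
pose proof (Rpower_gt0 (a n) q); pose proof (Rpower_gt0 2 (INR l * q)).
pose proof (Rpower_gt0 (d n) (- ((INR l + 1) * q))).
set (X := Rpower (d n) (- ((INR l + 1) * q))) in *.
rewrite <- Rmult_assoc, <- Rmult_assoc; apply Rmult_le_compat_r; [lra|]; nra.
Qed.

(** * Passage to the infinite product *)

Lemma partial_sum_S (a : nat -> R) (n : nat) : partial_sum a (S n) = sum_n a n.
Proof.
induction n as [|n IH].
- rewrite sum_O; simpl; ring.
- rewrite sum_Sn, <- IH; reflexivity.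
Qed.

Lemma partial_sum_lim (a : nat -> R) :
  ex_series a -> is_lim_seq (partial_sum a) (Series a).
Proof.
intros H; apply is_lim_seq_incr_1.
apply is_lim_seq_ext with (sum_n a); [intros n; symmetry; apply partial_sum_S|].
exact (Series_correct a H).
Qed.

Lemma partial_sum_incr (a : nat -> R) (N M : nat) :
  (forall n, 0 <= a n) -> (N <= M)%nat -> partial_sum a N <= partial_sum a M.
Proof.
intros Ha H; induction H as [|M H IH]; simpl; [lra|]; pose proof (Ha M); lra.
Qed.

Lemma partial_sum_le_Series (a : nat -> R) (N : nat) :
  (forall n, 0 <= a n) -> ex_series a -> partial_sum a N <= Series a.
Proof.
intros Ha H.
assert (L : Rbar_le (partial_sum a N) (Series a)); [|exact L].
apply is_lim_seq_le_loc with (fun _ => partial_sum a N) (partial_sum a).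
- exists N; intros n Hn; apply partial_sum_incr; assumption.
- apply is_lim_seq_const.
- apply partial_sum_lim; exact H.
Qed.

Definition tail_sum (a : nat -> R) (N : nat) : R := Series a - partial_sum a N.

Lemma tail_sum_lim (a : nat -> R) : ex_series a -> is_lim_seq (tail_sum a) 0.
Proof.
intros H; replace (Finite 0) with (Finite (Series a - Series a)) by (f_equal; ring).
apply is_lim_seq_minus'; [apply is_lim_seq_const|apply partial_sum_lim; exact H].
Qed.

(** Summable increments make [u] a Cauchy sequence, so [real (Lim_seq u)] is a genuine finite limit
    and not a default value; letting [M] grow in the bound on [u M - u N] gives the rate. *)
Lemma Lim_seq_increment_bound (u a : nat -> R) (c : R) :
  0 <= c -> (forall n, 0 <= a n) -> ex_series a ->
  (forall n, Rabs (u (S n) - u n) <= c * a n) ->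
  forall N, Rabs (u N - real (Lim_seq u)) <= c * tail_sum a N.
Proof.
intros Hc Ha Hs Hu.
assert (H1 : forall N M, (N <= M)%nat ->
  Rabs (u M - u N) <= c * (partial_sum a M - partial_sum a N)).
{ intros N M H; induction H as [|M H IH].
  - rewrite !Rminus_diag, Rabs_R0; lra.
  - simpl; replace (u (S M) - u N) with ((u (S M) - u M) + (u M - u N)) by ring.
    eapply Rle_trans; [apply Rabs_triang|]; pose proof (Hu M); lra. }
assert (H2 : forall N M, (N <= M)%nat -> Rabs (u M - u N) <= c * tail_sum a N).
{ intros N M H; eapply Rle_trans; [apply H1; exact H|].
  apply Rmult_le_compat_l; [exact Hc|].
  unfold tail_sum; pose proof (partial_sum_le_Series a M Ha Hs); lra. }
assert (HL : is_lim_seq (fun N => c * tail_sum a N) 0).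
{ replace (Finite 0) with (Rbar_mult c 0) by (simpl; f_equal; ring).
  apply is_lim_seq_scal_l, tail_sum_lim; exact Hs. }
assert (E : ex_finite_lim_seq u).
{ apply ex_lim_seq_cauchy_corr; intros eps.
  apply is_lim_seq_spec in HL; destruct (HL (pos_div_2 eps)) as [N0 H0].
  specialize (H0 N0 (le_n _)); simpl in H0; rewrite Rminus_0_r in H0.
  pose proof (Rle_abs (c * tail_sum a N0)).
  exists N0; intros n m Hn Hm.
  replace (u n - u m) with ((u n - u N0) - (u m - u N0)) by ring.
  eapply Rle_lt_trans; [apply Rabs_triang|]; rewrite Rabs_Ropp.
  pose proof (H2 _ _ Hn); pose proof (H2 _ _ Hm); lra. }
apply Lim_seq_correct' in E.
intros N; rewrite Rabs_minus_sym.
assert (L : Rbar_le (Rabs (real (Lim_seq u) - u N)) (c * tail_sum a N)); [|exact L].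
apply is_lim_seq_le_loc with (fun M => Rabs (u M - u N)) (fun _ => c * tail_sum a N).
- exists N; intros n Hn; apply H2; exact Hn.
- apply (is_lim_seq_abs (fun M => u M - u N) (real (Lim_seq u) - u N)).
  apply is_lim_seq_minus'; [exact E|apply is_lim_seq_const].
- apply is_lim_seq_const.
Qed.

Lemma CVU_of_bound (f : nat -> R -> R) (g : R -> R) (e : nat -> R) (c : R) (r : posreal) :
  is_lim_seq e 0 -> (forall n y, Boule c r y -> Rabs (f n y - g y) <= e n) ->
  CVU f g c r.
Proof.
intros He H eps Heps; apply is_lim_seq_spec in He.
destruct (He (mkposreal eps Heps)) as [N HN]; exists N; intros n y Hn Hy.
specialize (HN n Hn); simpl in HN; rewrite Rminus_0_r in HN.
rewrite Rabs_minus_sym; eapply Rle_lt_trans; [apply H; exact Hy|].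
pose proof (Rle_abs (e n)); lra.
Qed.

Lemma is_derive_difference_quotient (f g : R -> R) (x d : R) :
  is_derive f x d -> (forall t, t <> x -> g t = (f t - f x) / (t - x)) ->
  Lim g x = d.
Proof.
intros Hf Hg; apply is_lim_unique, is_lim_spec; intros eps.
apply is_derive_Reals in Hf; destruct (Hf eps (cond_pos eps)) as [del H].
exists del; intros t Ht Hne; rewrite Hg by exact Hne.
assert (h0 : t - x <> 0) by lra.
specialize (H (t - x) h0 Ht); rewrite (Rplus_minus x t) in H; exact H.
Qed.

(** On a horizontal line the increment of the variable is real, so the complex difference quotient
    splits into two real ones. *)
Lemma C_derive_of_is_Cderive (f : C -> C) (w d : C) :
  is_Cderive (fun t => f (t, snd w)) (fst w) d -> C_derive f w = d.
Proof.
intros [H1 H2]; unfold C_derive, C_lim.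
rewrite (is_derive_difference_quotient _ _ _ _ H1),
  (is_derive_difference_quotient _ _ _ _ H2).
- destruct d; reflexivity.
- intros t Ht; destruct w as [x y]; simpl in *.
  unfold Im, Re; simpl; field; split; [lra|].
  assert (t - x <> 0) by lra; nra.
- intros t Ht; destruct w as [x y]; simpl in *.
  unfold Im, Re; simpl; field; split; [lra|].
  assert (t - x <> 0) by lra; nra.
Qed.

Lemma is_Cderive_ext_loc (f g : R -> C) (x : R) (d : C) :
  locally x (fun t => f t = g t) -> is_Cderive f x d -> is_Cderive g x d.
Proof.
intros E [f1 f2]; split.
- refine (is_derive_ext_loc _ _ _ _ _ f1).
  apply filter_imp with (2 := E); intros t Et; rewrite Et; reflexivity.
- refine (is_derive_ext_loc _ _ _ _ _ f2).
  apply filter_imp with (2 := E); intros t Et; rewrite Et; reflexivity.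
Qed.

Lemma Cmod_le_Re_Im (c : C) : Cmod c <= Rabs (Re c) + Rabs (Im c).
Proof.
replace c with (RtoC (Re c) + Ci * RtoC (Im c))%C
  by (destruct c; unfold Re, Im, RtoC, Ci, Cplus, Cmult; simpl; f_equal; ring).
eapply Rle_trans; [apply Cmod_triangle|].
rewrite Cmod_mult, Cmod_Ci, !Cmod_R, Rmult_1_l.
unfold Re, Im, RtoC, Ci, Cplus, Cmult; simpl; right; f_equal; f_equal; ring.
Qed.

Lemma im_le_Cmod (c : C) : Rabs (Im c) <= Cmod c.
Proof. eapply Rle_trans; [apply Rmax_r|apply Rmax_Cmod]. Qed.

Lemma Cmod_polar (r t : R) : 0 <= r -> Cmod (polar r t) = r.
Proof.
intros H; unfold Cmod, polar; simpl.
replace (r * cos t * (r * cos t * 1) + r * sin t * (r * sin t * 1))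
  with (r * r * (Rsqr (sin t) + Rsqr (cos t))) by (unfold Rsqr; ring).
rewrite sin2_cos2, Rmult_1_r; apply sqrt_square; exact H.
Qed.

Lemma is_Cderive_polar (r t : R) : is_Cderive (polar r) t (- r * sin t, r * cos t).
Proof.
split; unfold polar, Re, Im; simpl; auto_derive; trivial; ring.
Qed.

Lemma is_Cderive_horizontal (x y : R) : is_Cderive (fun t => (t, y)) x 1%C.
Proof.
split; unfold Re, Im; simpl.
- exact (is_derive_id x).
- exact (is_derive_const y x).
Qed.

Lemma Cmod_horizontal (x t y : R) : Cmod (t, y) <= Cmod (x, y) + Rabs (t - x).
Proof.
replace (t, y) with ((x, y) + RtoC (t - x))%C
  by (unfold RtoC, Cplus; simpl; f_equal; ring).
eapply Rle_trans; [apply Cmod_triangle|]; rewrite Cmod_R; lra.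
Qed.

(** The value is [B^(k)(w) / k!]. The componentwise limits match those of [Blaschke_product], so
    that [k = 0] reduces to [taylor_0]. *)
Definition taylor_lim (z : nat -> C) (k : nat) (w : C) : C :=
  (real (Lim_seq (fun N => Re (taylor z N w k))),
   real (Lim_seq (fun N => Im (taylor z N w k)))).

(** * Derivatives of the infinite product as limits of Taylor coefficients *)

Section Limit.

Variable z : nat -> C.
Hypothesis hB : Blaschke_sequence z.

Let a := fun n => 1 - Cmod (z n).

Lemma gap_ge0 (n : nat) : 0 <= a n.
Proof. unfold a; destruct hB as [H _]; pose proof (proj2 (H n)); lra. Qed.

Lemma ex_series_gap : ex_series a.
Proof. exact (proj2 hB). Qed.

(** The constant of [taylor_increment] times the tail of the Blaschke sum. It depends on [w] only
    through [delta], which is what makes the convergence uniform. *)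
Definition conv_rate (delta : R) (k N : nat) : R :=
  4 / delta ^ 2 / (delta / 3) ^ k * tail_sum (fun n => 1 - Cmod (z n)) N.

Lemma conv_rate_lim (delta : R) (k : nat) : is_lim_seq (conv_rate delta k) 0.
Proof.
unfold conv_rate.
replace (Finite 0) with (Rbar_mult (4 / delta ^ 2 / (delta / 3) ^ k) 0)
  by (simpl; f_equal; ring).
apply is_lim_seq_scal_l, tail_sum_lim, ex_series_gap.
Qed.

Lemma taylor_lim_rate (w : C) (delta : R) (k N : nat) :
  0 < delta -> Cmod w <= 1 - delta ->
  Rabs (Re (taylor z N w k) - Re (taylor_lim z k w)) <= conv_rate delta k N /\
  Rabs (Im (taylor z N w k) - Im (taylor_lim z k w)) <= conv_rate delta k N.
Proof.
intros hd hw.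
assert (Hc : 0 <= 4 / delta ^ 2 / (delta / 3) ^ k).
{ apply Rlt_le, Rdiv_lt_0_compat; [apply Rdiv_lt_0_compat; [lra|]|];
    apply pow_lt; lra. }
pose proof (fun n => taylor_increment z w delta (proj1 hB) hd hw n k) as I.
split.
- apply (Lim_seq_increment_bound (fun n => Re (taylor z n w k)) a _ Hc gap_ge0
    ex_series_gap).
  intros n; eapply Rle_trans; [|apply I].
  eapply Rle_trans; [|apply re_le_Cmod]; right; f_equal.
- apply (Lim_seq_increment_bound (fun n => Im (taylor z n w k)) a _ Hc gap_ge0
    ex_series_gap).
  intros n; eapply Rle_trans; [|apply I].
  eapply Rle_trans; [|apply im_le_Cmod]; right; f_equal.
Qed.

Lemma Cmod_taylor_lim_rate (w : C) (delta : R) (k N : nat) :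
  0 < delta -> Cmod w <= 1 - delta ->
  Cmod (taylor_lim z k w - taylor z N w k)%C <= 2 * conv_rate delta k N.
Proof.
intros hd hw; destruct (taylor_lim_rate w delta k N hd hw) as [H1 H2].
replace (taylor_lim z k w - taylor z N w k)%C
  with (- (taylor z N w k - taylor_lim z k w))%C by ring.
rewrite Cmod_opp; eapply Rle_trans; [apply Cmod_le_Re_Im|].
unfold Re, Im in *; simpl in *; unfold Rminus in *; lra.
Qed.

Lemma denom_neq0_of_lt1 (w : C) (n : nat) :
  Cmod w < 1 -> (1 - Cconj (z n) * w <> 0)%C.
Proof.
intros H; destruct (proj1 hB n) as [h0 h1].
apply (denom_neq0 (z n) w (1 - Cmod w) h0 h1); lra.
Qed.

(** Termwise differentiation: the derivatives are again Taylor coefficients, of order [k + 1], and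
    converge uniformly near [x] at their own rate. *)
Lemma is_Cderive_taylor_lim (x y : R) (k : nat) :
  Cmod (x, y) < 1 ->
  is_Cderive (fun t => taylor_lim z k (t, y)) x
    (Cnat (S k) * taylor_lim z (S k) (x, y))%C.
Proof.
intros H.
(* Half the distance to the unit circle: moving by less than [delta] from a point of modulus
   [1 - 2 * delta] stays in the disc of radius [1 - delta]. *)
set (delta := (1 - Cmod (x, y)) / 2).
assert (hd : 0 < delta) by (unfold delta; lra).
set (r := mkposreal delta hd).
assert (hball : forall t, Boule x r t -> Cmod (t, y) <= 1 - delta).
{ intros t Ht; unfold Boule in Ht; simpl in Ht.
  pose proof (Cmod_horizontal x t y); unfold delta in *; lra. }
assert (hD : forall N t, Boule x r t ->
  is_Cderive (fun t => taylor z N (t, y) k) t (Cnat (S k) * taylor z N (t, y) (S k))%C).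
{ intros N t Ht.
  refine (is_Cderive_eq _ _ _ _ (is_Cderive_taylor z (fun t => (t, y)) t 1%C
    (is_Cderive_horizontal t y) _ N k) _); [|ring].
  intros n; apply denom_neq0_of_lt1; pose proof (hball t Ht); lra. }
assert (Hx : Boule x r x).
{ unfold Boule; rewrite Rminus_diag, Rabs_R0; exact hd. }
assert (Hrate : is_lim_seq (fun n => INR (S k) * conv_rate delta (S k) n) 0).
{ replace (Finite 0) with (Rbar_mult (INR (S k)) 0) by (simpl; f_equal; ring).
  apply is_lim_seq_scal_l, conv_rate_lim. }
assert (Hpt : forall u v : nat -> R, is_lim_seq v 0 -> forall L,
  (forall n, Rabs (u n - L) <= v n) -> Un_cv u L).
{ intros u v Hv L Huv; apply is_lim_seq_Reals.
  apply is_lim_seq_spec in Hv; apply is_lim_seq_spec; intros eps.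
  destruct (Hv eps) as [N0 H0]; exists N0; intros n Hn; specialize (H0 n Hn).
  rewrite Rminus_0_r in H0; pose proof (Rle_abs (v n)); pose proof (Huv n); lra. }
assert (Hk : 0 <= INR (S k)) by apply pos_INR.
split; apply is_derive_Reals.
- refine (CVU_derivable (fun n t => Re (taylor z n (t, y) k))
    (fun n t => INR (S k) * Re (taylor z n (t, y) (S k)))
    (fun t => Re (taylor_lim z k (t, y)))
    (fun t => Re (Cnat (S k) * taylor_lim z (S k) (t, y))) x r _ _ _ x Hx).
  + apply CVU_of_bound with (1 := Hrate); intros n t Ht.
    destruct (taylor_lim_rate (t, y) delta (S k) n hd (hball t Ht)) as [R1 _].
    replace (Re (Cnat (S k) * taylor_lim z (S k) (t, y)))
      with (INR (S k) * Re (taylor_lim z (S k) (t, y)))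
      by (unfold Re, Cnat, RtoC; simpl; ring).
    rewrite <- Rmult_minus_distr_l, Rabs_mult, Rabs_pos_eq by exact Hk.
    apply Rmult_le_compat_l; assumption.
  + intros t Ht; apply Hpt with (1 := conv_rate_lim delta k); intros n.
    apply (taylor_lim_rate (t, y) delta k n hd (hball t Ht)).
  + intros n t Ht; apply is_derive_Reals; destruct (hD n t Ht) as [D1 _].
    refine (is_derive_eq _ _ _ _ D1 _); unfold Re, Cnat, RtoC; simpl; ring.
- refine (CVU_derivable (fun n t => Im (taylor z n (t, y) k))
    (fun n t => INR (S k) * Im (taylor z n (t, y) (S k)))
    (fun t => Im (taylor_lim z k (t, y)))
    (fun t => Im (Cnat (S k) * taylor_lim z (S k) (t, y))) x r _ _ _ x Hx).
  + apply CVU_of_bound with (1 := Hrate); intros n t Ht.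
    destruct (taylor_lim_rate (t, y) delta (S k) n hd (hball t Ht)) as [_ R1].
    replace (Im (Cnat (S k) * taylor_lim z (S k) (t, y)))
      with (INR (S k) * Im (taylor_lim z (S k) (t, y)))
      by (unfold Im, Cnat, RtoC; simpl; ring).
    rewrite <- Rmult_minus_distr_l, Rabs_mult, Rabs_pos_eq by exact Hk.
    apply Rmult_le_compat_l; assumption.
  + intros t Ht; apply Hpt with (1 := conv_rate_lim delta k); intros n.
    apply (taylor_lim_rate (t, y) delta k n hd (hball t Ht)).
  + intros n t Ht; apply is_derive_Reals; destruct (hD n t Ht) as [_ D1].
    refine (is_derive_eq _ _ _ _ D1 _); unfold Im, Cnat, RtoC; simpl; ring.
Qed.

Lemma C_derive_n_Blaschke (k : nat) (w : C) :
  Cmod w < 1 ->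
  C_derive_n (Blaschke_product z) k w = (Cnat (fact k) * taylor_lim z k w)%C.
Proof.
revert w; induction k as [|k IH]; intros w Hw.
- simpl; unfold Cnat; simpl; rewrite Cmult_1_l.
  unfold Blaschke_product, taylor_lim; f_equal; f_equal; apply Lim_seq_ext;
    intros N; rewrite taylor_0; reflexivity.
- change (C_derive_n (Blaschke_product z) (S k) w)
    with (C_derive (C_derive_n (Blaschke_product z) k) w).
  destruct w as [x y]; apply C_derive_of_is_Cderive; simpl fst; simpl snd.
  apply is_Cderive_ext_loc with (fun t => Cnat (fact k) * taylor_lim z k (t, y))%C.
  (* The induction hypothesis is available only inside the disc, so the two functions are compared
     on a neighbourhood of [x]. *)
  + assert (hd : 0 < 1 - Cmod (x, y)) by lra.
    exists (mkposreal _ hd); intros t Ht; symmetry; apply IH.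
    change (Rabs (t - x) < 1 - Cmod (x, y)) in Ht.
    eapply Rle_lt_trans; [apply (Cmod_horizontal x)|]; lra.
  + refine (is_Cderive_eq _ _ _ _ (is_Cderive_mult _ _ _ _ _ (is_Cderive_const _ _)
      (is_Cderive_taylor_lim x y k Hw)) _).
    replace (fact (S k)) with (S k * fact k)%nat by reflexivity.
    unfold Cnat; rewrite mult_INR, RtoC_mult; ring.
Qed.

(** Provides the integrability of the circle means. The rate is uniform on the whole circle, so the
    radius [1] of the interval around [theta] is arbitrary. *)
Lemma continuous_taylor_lim_polar (r theta : R) (k : nat) :
  0 <= r < 1 ->
  continuous (fun t => Re (taylor_lim z k (polar r t))) theta /\
  continuous (fun t => Im (taylor_lim z k (polar r t))) theta.
Proof.
intros Hr; set (delta := 1 - r); assert (hd : 0 < delta) by (unfold delta; lra).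
assert (hp : forall t, Cmod (polar r t) <= 1 - delta).
{ intros t; rewrite Cmod_polar by lra; unfold delta; lra. }
assert (hx : Boule theta (mkposreal 1 Rlt_0_1) theta).
{ unfold Boule; simpl; rewrite Rminus_diag, Rabs_R0; lra. }
assert (hD : forall N t, exists d, is_Cderive (fun t => taylor z N (polar r t) k) t d).
{ intros N t; eexists; apply is_Cderive_taylor; [apply is_Cderive_polar|].
  intros n; apply denom_neq0_of_lt1; pose proof (hp t); lra. }
split; apply continuity_pt_filterlim.
- apply (CVU_continuity (fun n t => Re (taylor z n (polar r t) k)) _ theta
    (mkposreal 1 Rlt_0_1)); [|intros n y _|exact hx].
  + apply CVU_of_bound with (1 := conv_rate_lim delta k); intros n y _.
    apply (taylor_lim_rate (polar r y) delta k n hd (hp y)).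
  + destruct (hD n y) as [d [D _]]; apply continuity_pt_filterlim.
    apply (ex_derive_continuous (fun t => Re (taylor z n (polar r t) k))); eexists; exact D.
- apply (CVU_continuity (fun n t => Im (taylor z n (polar r t) k)) _ theta
    (mkposreal 1 Rlt_0_1)); [|intros n y _|exact hx].
  + apply CVU_of_bound with (1 := conv_rate_lim delta k); intros n y _.
    apply (taylor_lim_rate (polar r y) delta k n hd (hp y)).
  + destruct (hD n y) as [d [_ D]]; apply continuity_pt_filterlim.
    apply (ex_derive_continuous (fun t => Im (taylor z n (polar r t) k))); eexists; exact D.
Qed.

End Limit.

(** * Integrals of the kernels *)

Lemma ex_RInt_cont (g : R -> R) (a b : R) : (forall t, continuous g t) -> ex_RInt g a b.
Proof. intros H; apply (ex_RInt_continuous (V := R_CompleteNormedModule)); auto. Qed.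

Lemma RInt_shift (g : R -> R) (v a b : R) :
  (forall t, continuous g t) -> RInt (fun t => g (t + v)) a b = RInt g (a + v) (b + v).
Proof.
intros Hg; replace (a + v) with (1 * a + v) by ring; replace (b + v) with (1 * b + v) by ring.
rewrite <- (RInt_comp_lin g 1 v a b) by (apply ex_RInt_cont; exact Hg).
apply RInt_ext; intros t _.
change (g (t + v) = 1 * g (1 * t + v)); rewrite !Rmult_1_l; reflexivity.
Qed.

Lemma RInt_periodic (g : R -> R) (T a b : R) :
  (forall t, continuous g t) -> (forall t, g (t + T) = g t) ->
  RInt g a (a + T) = RInt g b (b + T).
Proof.
intros Hg HT.
assert (E : forall u v, ex_RInt g u v) by (intros; apply ex_RInt_cont; exact Hg).
assert (S1 : RInt g (b + T) (a + T) = RInt g b a).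
{ rewrite <- RInt_shift by exact Hg; apply RInt_ext; intros t _; apply HT. }
pose proof (RInt_Chasles g a b (b + T) (E _ _) (E _ _)) as C1.
pose proof (RInt_Chasles g a (b + T) (a + T) (E _ _) (E _ _)) as C2.
pose proof (opp_RInt_swap g a b (E _ _)) as C3.
unfold plus, opp in *; simpl in *; lra.
Qed.

Lemma RInt_even (g : R -> R) (a : R) :
  (forall t, continuous g t) -> (forall t, g (- t) = g t) ->
  RInt g (- a) a = 2 * RInt g 0 a.
Proof.
intros Hg He.
assert (E : forall u v, ex_RInt g u v) by (intros; apply ex_RInt_cont; exact Hg).
assert (S1 : RInt g (- a) 0 = RInt g 0 a).
{ replace (- a) with (- (1) * a + 0) by ring.
  replace 0 with (- (1) * 0 + 0) at 2 by ring.
  rewrite <- (RInt_comp_lin g (- (1)) 0 a 0) by apply E.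
  rewrite <- (opp_RInt_swap g a 0), <- (RInt_opp g) by apply E.
  apply RInt_ext; intros t _.
  change (- (1) * g (- (1) * t + 0) = - g t).
  rewrite <- (He t); replace (- (1) * t + 0) with (- t) by ring; ring. }
pose proof (RInt_Chasles g (- a) 0 a (E _ _) (E _ _)) as C1.
unfold plus in *; simpl in *; lra.
Qed.

(** The minorant [x - x ^ 3 / 6] is at least [x / 3] as long as [x ^ 2 <= 4]. The range contains all
    half-angles [phi / 2] with [phi <= PI], since [PI <= 4]. *)
Lemma sin_ge_third (x : R) : 0 <= x <= 2 -> x / 3 <= sin x.
Proof.
intros Hx; destruct (pre_sin_bound x 0) as [H _]; try lra.
unfold sin_approx, sin_term in H; simpl in H; nra.
Qed.

Lemma cos_double_half (x : R) : 1 - cos x = 2 * sin (x / 2) ^ 2.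
Proof.
replace x with (2 * (x / 2)) at 1 by field.
rewrite cos_2a_sin; ring.
Qed.

(** This is [|1 - rho * e^(i phi)|]. *)
Definition kernel_norm (rho phi : R) : R := sqrt (1 - 2 * rho * cos phi + rho ^ 2).

Lemma kernel_norm2_ge (rho phi : R) : 0 <= rho ->
  (1 - rho) ^ 2 <= 1 - 2 * rho * cos phi + rho ^ 2.
Proof. intros H; pose proof (COS_bound phi); nra. Qed.

Lemma kernel_norm_ge_gap (rho phi : R) : 0 <= rho < 1 -> 1 - rho <= kernel_norm rho phi.
Proof.
intros H; unfold kernel_norm; rewrite <- (sqrt_pow2 (1 - rho)) by lra.
apply sqrt_le_1_alt, kernel_norm2_ge; lra.
Qed.

(** Here [sin (phi / 2) ^ 2 = (1 - cos phi) / 2]. For [cos phi >= 0], the squared norm is [(rho -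
    cos phi) ^ 2 + (1 - cos phi) * (1 + cos phi)]; for [cos phi < 0] it is at least [1]. *)
Lemma kernel_norm_ge_sin (rho phi : R) : 0 <= rho -> 0 <= phi <= PI ->
  sin (phi / 2) <= kernel_norm rho phi.
Proof.
intros H Hphi.
assert (Hs : 0 <= sin (phi / 2)) by (apply sin_ge_0; lra).
rewrite <- (sqrt_pow2 (sin (phi / 2))) by exact Hs.
apply sqrt_le_1_alt; pose proof (cos_double_half phi) as E.
pose proof (COS_bound phi).
assert (F : sin (phi / 2) ^ 2 = (1 - cos phi) / 2) by lra; rewrite F.
destruct (Rle_dec 0 (cos phi)); [|nra].
assert (0 <= (rho - cos phi) ^ 2) by apply pow2_ge_0; nra.
Qed.

(** Six times each of the two lower bounds, added, with [sin (phi / 2) >= phi / 6]. A bound additive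
    in [phi] has powers with an explicit antiderivative. *)
Lemma kernel_norm_lower (rho phi : R) : 0 <= rho < 1 -> 0 <= phi <= PI ->
  6 * (1 - rho) + phi <= 12 * kernel_norm rho phi.
Proof.
intros H Hphi.
pose proof (kernel_norm_ge_gap rho phi H).
pose proof (kernel_norm_ge_sin rho phi (proj1 H) Hphi).
pose proof PI_4; pose proof (sin_ge_third (phi / 2)); lra.
Qed.

Lemma Rpower_le_contravar (x y p : R) : 0 < x <= y -> p <= 0 -> Rpower y p <= Rpower x p.
Proof.
intros Hxy Hp; replace p with (- - p) by ring; rewrite !(Rpower_Ropp _ (- p)).
apply Rinv_le_contravar; [apply Rpower_gt0|apply Rle_Rpower_l; lra].
Qed.

Lemma is_derive_Rpower (x p : R) : 0 < x ->
  is_derive (fun t => Rpower t p) x (p * Rpower x (p - 1)).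
Proof. intros H; apply is_derive_Reals, derivable_pt_lim_power; exact H. Qed.

Lemma continuous_Rpower_comp (f : R -> R) (p t : R) :
  0 < f t -> continuous f t -> continuous (fun u => Rpower (f u) p) t.
Proof.
intros H Hf; apply (continuous_comp f (fun x => Rpower x p)); [exact Hf|].
apply (ex_derive_continuous (fun x => Rpower x p)); eexists; apply is_derive_Rpower; exact H.
Qed.

Lemma continuous_kernel_norm (rho phi : R) : 0 <= rho < 1 -> continuous (kernel_norm rho) phi.
Proof.
intros H; apply (ex_derive_continuous (kernel_norm rho)).
unfold kernel_norm; auto_derive.
pose proof (kernel_norm2_ge rho phi (proj1 H)); nra.
Qed.

Lemma is_RInt_Rpower_shift (e s b : R) : 0 < e -> 1 < s -> 0 <= b ->
  is_RInt (fun t => Rpower (e + t) (- s)) 0 b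
    (/ (s - 1) * Rpower e (1 - s) - / (s - 1) * Rpower (e + b) (1 - s)).
Proof.
intros He Hs Hb.
replace (/ (s - 1) * Rpower e (1 - s) - / (s - 1) * Rpower (e + b) (1 - s))
  with (minus ((fun t => - / (s - 1) * Rpower (e + t) (1 - s)) b)
    ((fun t => - / (s - 1) * Rpower (e + t) (1 - s)) 0))
  by (unfold minus, plus, opp; simpl; rewrite Rplus_0_r; ring).
apply (is_RInt_derive (fun t => - / (s - 1) * Rpower (e + t) (1 - s))
  (fun t => Rpower (e + t) (- s))); rewrite Rmin_left, Rmax_right by lra;
  intros t Ht.
- refine (is_derive_eq _ _ _ _ (is_derive_scal _ _ _ _
    (is_derive_comp (fun x => Rpower x (1 - s)) (fun t => e + t) t _ 1
      (is_derive_Rpower (e + t) (1 - s) _) _)) _).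
  + lra.
  + auto_derive; trivial; ring.
  + unfold scal; simpl; unfold mult; simpl.
    replace (1 - s - 1) with (- s) by ring; field; lra.
- apply continuous_Rpower_comp; [lra|].
  apply (ex_derive_continuous (fun t => e + t)); auto_derive; trivial.
Qed.

(** The kernel is compared with [((e + t) / 12) ^ (- s)], whence [12 ^ s]; the negative boundary
    term at [PI] is dropped, and [e >= 1 - rho] with [1 - s < 0]. *)
Lemma kernel_half_integral (rho s : R) : 0 <= rho < 1 -> 1 < s ->
  RInt (fun phi => Rpower (kernel_norm rho phi) (- s)) 0 PI
  <= Rpower 12 s / (s - 1) * Rpower (1 - rho) (1 - s).
Proof.
intros H Hs; set (e := 6 * (1 - rho)).
assert (He : 0 < e) by (unfold e; lra).
pose proof PI_RGT_0 as Hpi.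
pose proof (is_RInt_Rpower_shift e s PI He Hs (Rlt_le _ _ Hpi)) as I.
assert (J : is_RInt (fun t => Rpower 12 s * Rpower (e + t) (- s)) 0 PI
  (Rpower 12 s * (/ (s - 1) * Rpower e (1 - s) - / (s - 1) * Rpower (e + PI) (1 - s))))
  by exact (is_RInt_scal _ _ _ (Rpower 12 s) _ I).
apply Rle_trans with (RInt (fun t => Rpower 12 s * Rpower (e + t) (- s)) 0 PI).
- apply RInt_le; [lra| | |].
  + apply (ex_RInt_continuous (V := R_CompleteNormedModule)); intros t _.
    apply continuous_Rpower_comp; [|apply continuous_kernel_norm; exact H].
    pose proof (kernel_norm_ge_gap rho t H); lra.
  + eexists; exact J.
  + intros t Ht; pose proof (kernel_norm_lower rho t H ltac:(lra)) as L; fold e in L.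
    apply Rle_trans with (Rpower ((e + t) / 12) (- s)).
    * apply Rpower_le_contravar; lra.
    * unfold Rdiv; rewrite <- Rpower_mult_distr by lra.
      replace (/ 12) with (Rpower 12 (- (1))) by (rewrite Rpower_Ropp, Rpower_1; lra).
      rewrite Rpower_mult; replace (- (1) * - s) with s by ring; lra.
- rewrite (is_RInt_unique _ _ _ _ J).
  assert (L : Rpower e (1 - s) <= Rpower (1 - rho) (1 - s))
    by (apply Rpower_le_contravar; unfold e; lra).
  pose proof (Rpower_gt0 (e + PI) (1 - s)); pose proof (Rpower_gt0 12 s).
  assert (0 < / (s - 1)) by (apply Rinv_0_lt_compat; lra).
  unfold Rdiv; rewrite Rmult_assoc; apply Rmult_le_compat_l; [lra|]; nra.
Qed.

Lemma Cmod_denom_polar (rho theta0 x theta : R) :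
  Cmod (1 - Cconj (polar rho theta0) * polar x theta)%C
  = kernel_norm (rho * x) (theta + - theta0).
Proof.
unfold kernel_norm, Cmod, polar; simpl; f_equal.
rewrite cos_plus, cos_neg, sin_neg.
pose proof (sin2_cos2 theta) as E1; pose proof (sin2_cos2 theta0) as E2.
unfold Rsqr in *.
set (c := cos theta) in *; set (s := sin theta) in *.
set (c0 := cos theta0) in *; set (s0 := sin theta0) in *.
transitivity (1 - 2 * (rho * x) * (c * c0 + s * s0)
  + rho * rho * (x * x) * ((s * s + c * c) * (s0 * s0 + c0 * c0))); [ring|].
rewrite E1, E2; ring.
Qed.

Lemma continuous_kernel (rho theta0 x s theta : R) : 0 <= rho * x < 1 ->
  continuous (fun t => Rpower (Cmod (1 - Cconj (polar rho theta0) * polar x t)%C) (- s)) theta.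
Proof.
intros H.
apply (continuous_ext (fun t => Rpower (kernel_norm (rho * x) (t + - theta0)) (- s))).
{ intros t; rewrite Cmod_denom_polar; reflexivity. }
apply (continuous_Rpower_comp (fun t => kernel_norm (rho * x) (t + - theta0))).
- pose proof (kernel_norm_ge_gap (rho * x) (theta + - theta0) H); lra.
- apply (continuous_comp (fun t => t + - theta0) (kernel_norm (rho * x))).
  + apply (ex_derive_continuous (fun t => t + - theta0)); auto_derive; trivial.
  + apply continuous_kernel_norm; exact H.
Qed.

(** Periodicity removes the rotation by [theta0] and moves the interval to [[-PI, PI]]; evenness
    gives the factor [2] and leaves [[0, PI]], where the lower bound on [kernel_norm] holds. *)
Lemma kernel_integral (rho theta0 x s : R) : 0 <= rho * x < 1 -> 1 < s ->
  RInt (fun t => Rpower (Cmod (1 - Cconj (polar rho theta0) * polar x t)%C) (- s)) 0 (2 * PI)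
  <= 2 * Rpower 12 s / (s - 1) * Rpower (1 - rho * x) (1 - s).
Proof.
intros H Hs; set (g := fun phi => Rpower (kernel_norm (rho * x) phi) (- s)).
assert (Hg : forall t, continuous g t).
{ intros t; apply continuous_Rpower_comp; [|apply continuous_kernel_norm; exact H].
  pose proof (kernel_norm_ge_gap (rho * x) t H); lra. }
rewrite (RInt_ext _ (fun t => g (t + - theta0))).
2:{ intros t _; rewrite Cmod_denom_polar; reflexivity. }
rewrite RInt_shift by exact Hg.
replace (2 * PI + - theta0) with ((0 + - theta0) + 2 * PI) by ring.
rewrite (RInt_periodic g (2 * PI) _ (- PI) Hg).
2:{ intros t; unfold g, kernel_norm; rewrite cos_plus, cos_2PI, sin_2PI.
    do 3 f_equal; ring. }
replace (- PI + 2 * PI) with PI by ring.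
rewrite RInt_even by (try exact Hg; intros t; unfold g, kernel_norm; rewrite cos_neg; reflexivity).
pose proof (kernel_half_integral (rho * x) s H Hs) as K; fold g in K.
unfold Rdiv in *; lra.
Qed.

(** * Circle means *)

Lemma rpow_lt_of_lt_root (x p eps : R) : 0 < p -> 0 < eps ->
  x < Rpower eps (/ p) -> rpow x p < eps.
Proof.
intros Hp He Hx; destruct (Rlt_dec 0 x) as [H|H].
- rewrite rpow_pos by exact H.
  replace eps with (Rpower (Rpower eps (/ p)) p).
  + apply Rlt_Rpower_l; lra.
  + rewrite Rpower_mult, Rinv_l by lra; apply Rpower_1; exact He.
- rewrite rpow_nonpos by lra; exact He.
Qed.

Lemma continuous_rpow (p x : R) : 0 < p -> continuous (fun t => rpow t p) x.
Proof.
intros Hp; destruct (Rlt_dec 0 x) as [Hx|Hx].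
- apply (continuous_ext_loc _ (fun t => Rpower t p)).
  + exists (mkposreal x Hx); intros t Ht; change (Rabs (t - x) < x) in Ht.
    symmetry; apply rpow_pos; apply Rabs_def2 in Ht; lra.
  + apply (continuous_Rpower_comp (fun t => t)); [exact Hx|apply continuous_id].
(* At [x <= 0] the value is [0]: any [t] within [eps ^ (1/p)] of [x] is below [eps ^ (1/p)], and
   negative [t] contribute [0]. *)
- intros P [eps HP].
  assert (Hd : 0 < Rpower eps (/ p)) by apply Rpower_gt0.
  exists (mkposreal _ Hd); intros t Ht; apply HP.
  change (Rabs (t - x) < Rpower eps (/ p)) in Ht.
  change (Rabs (rpow t p - rpow x p) < eps).
  rewrite (rpow_nonpos x) by lra; rewrite Rminus_0_r, Rabs_pos_eq by apply rpow_ge0.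
  apply rpow_lt_of_lt_root; [exact Hp|apply cond_pos|].
  apply Rabs_def2 in Ht; lra.
Qed.

Lemma rpow_lim0 (u : nat -> R) (p : R) : 0 < p ->
  is_lim_seq u 0 -> is_lim_seq (fun n => rpow (u n) p) 0.
Proof.
intros Hp Hu; apply is_lim_seq_spec in Hu; apply is_lim_seq_spec; intros eps.
destruct (Hu (mkposreal _ (Rpower_gt0 eps (/ p)))) as [N HN]; exists N; intros n Hn.
specialize (HN n Hn); simpl in HN; rewrite Rminus_0_r in *.
rewrite Rabs_pos_eq by apply rpow_ge0.
apply rpow_lt_of_lt_root; [exact Hp|apply cond_pos|].
pose proof (Rle_abs (u n)); lra.
Qed.

Lemma continuous_Cmod (f : R -> C) (t : R) :
  continuous (fun t => Re (f t)) t -> continuous (fun t => Im (f t)) t ->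
  continuous (fun t => Cmod (f t)) t.
Proof.
intros H1 H2; unfold Cmod.
apply (continuous_comp (fun t => fst (f t) ^ 2 + snd (f t) ^ 2) sqrt).
- apply (continuous_ext (fun t => plus (mult (Re (f t)) (Re (f t)))
    (mult (Im (f t)) (Im (f t))))).
  + intros u; unfold plus, mult, Re, Im; simpl; ring.
  + apply (continuous_plus (V := R_NormedModule));
      apply (continuous_mult (K := R_AbsRing)); assumption.
- apply continuous_sqrt.
Qed.

Lemma is_RInt_partial_sum (f : nat -> R -> R) (I : nat -> R) (a b : R) (N : nat) :
  (forall n, is_RInt (f n) a b (I n)) ->
  is_RInt (fun t => partial_sum (fun n => f n t) N) a b (partial_sum I N).
Proof.
intros H; induction N as [|N IH]; simpl.
- pose proof (is_RInt_const (V := R_NormedModule) a b 0) as H0.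
  change (is_RInt (fun _ : R => 0) a b ((b - a) * 0)) in H0.
  rewrite Rmult_0_r in H0; exact H0.
- exact (is_RInt_plus _ _ _ _ _ _ IH (H N)).
Qed.

Lemma continuous_rpow_taylor_lim (z : nat -> C) (l : nat) (p x t : R) :
  Blaschke_sequence z -> 0 < p -> 0 <= x < 1 ->
  continuous (fun t => rpow (Cmod (taylor_lim z l (polar x t))) p) t.
Proof.
intros hB hp hx.
destruct (continuous_taylor_lim_polar z hB x t l hx) as [c1 c2].
apply (continuous_comp (fun t => Cmod (taylor_lim z l (polar x t))) (fun u => rpow u p)).
- exact (continuous_Cmod (fun t => taylor_lim z l (polar x t)) t c1 c2).
- apply continuous_rpow; exact hp.
Qed.

(** By subadditivity, replacing the limit by the [N]-th partial product costs at most
    [(2 * conv_rate) ^ q] at each point of the circle, hence [2 * PI] times that in the integral.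
    This vanishes as [N] grows, whereas the main term is bounded by [M] for every [N]; no
    convergence theorem for integrals is involved. *)
Lemma circle_mean_taylor_lim (z : nat -> C) (r theta : nat -> R) (l : nat) (q x M : R) :
  Blaschke_sequence z -> (forall n, 0 < r n < 1) ->
  (forall n, z n = polar (r n) (theta n)) ->
  (1 <= l)%nat -> 0 < q -> INR l * q <= 1 -> 1 < (INR l + 1) * q -> 0 < x < 1 ->
  (forall N, partial_sum (fun n => Rpower (1 - r n) q
     * Rpower (1 - r n * x) (1 - (INR l + 1) * q)) N <= M) ->
  RInt (fun t => rpow (Cmod (taylor_lim z l (polar x t))) q) 0 (2 * PI)
  <= 4 * (2 * Rpower 12 ((INR l + 1) * q) / ((INR l + 1) * q - 1)) * M.
Proof.
intros hB hr hz hl hq hlq hs hx HM.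
set (s := (INR l + 1) * q) in *.
set (K := 2 * Rpower 12 s / (s - 1)).
assert (HK : 0 < K).
{ unfold K; pose proof (Rpower_gt0 12 s); apply Rdiv_lt_0_compat; lra. }
set (delta := 1 - x); assert (hd : 0 < delta) by (unfold delta; lra).
assert (hp : forall t, Cmod (polar x t) <= 1 - delta).
{ intros t; rewrite Cmod_polar by lra; unfold delta; lra. }
assert (hzn : forall n, Cmod (z n) = r n).
{ intros n; rewrite hz; apply Cmod_polar; pose proof (hr n); lra. }
assert (hrx : forall n, 0 <= r n * x < 1) by (intros n; pose proof (hr n); nra).
set (f := fun n t => Rpower (1 - r n) q
  * Rpower (Cmod (1 - Cconj (z n) * polar x t)%C) (- s)).
assert (Hf : forall n, ex_RInt (f n) 0 (2 * PI)).
{ intros n; apply (ex_RInt_scal (V := R_NormedModule)); apply ex_RInt_cont; intros t.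
  rewrite hz; apply continuous_kernel; apply hrx. }
assert (Hfle : forall n, RInt (f n) 0 (2 * PI)
  <= K * (Rpower (1 - r n) q * Rpower (1 - r n * x) (1 - s))).
{ intros n; unfold f.
  assert (E : RInt (fun t => Rpower (1 - r n) q
      * Rpower (Cmod (1 - Cconj (z n) * polar x t)%C) (- s)) 0 (2 * PI)
    = Rpower (1 - r n) q
      * RInt (fun t => Rpower (Cmod (1 - Cconj (z n) * polar x t)%C) (- s)) 0 (2 * PI)).
  { apply (RInt_scal (V := R_CompleteNormedModule)); apply ex_RInt_cont; intros t.
    rewrite hz; apply continuous_kernel; apply hrx. }
  rewrite E, hz.
  pose proof (kernel_integral (r n) (theta n) x s (hrx n) hs) as I; fold K in I.
  pose proof (Rpower_gt0 (1 - r n) q).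
  apply Rmult_le_compat_l with (r := Rpower (1 - r n) q) in I; lra. }
assert (HG : ex_RInt (fun t => rpow (Cmod (taylor_lim z l (polar x t))) q) 0 (2 * PI)).
{ apply ex_RInt_cont; intros t.
  apply continuous_rpow_taylor_lim; [exact hB|exact hq|lra]. }
pose proof PI_RGT_0 as Hpi.
assert (Hq1 : q <= 1).
{ assert (1 <= INR l) by (change 1 with (INR 1); apply le_INR; exact hl); nra. }
assert (step : forall N, RInt (fun t => rpow (Cmod (taylor_lim z l (polar x t))) q) 0 (2 * PI)
  <= 4 * K * M + 2 * PI * rpow (2 * conv_rate z delta l N) q).
{ intros N; set (e := rpow (2 * conv_rate z delta l N) q).
  assert (IS : is_RInt (fun t => 4 * partial_sum (fun n => f n t) N + e) 0 (2 * PI)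
    (4 * partial_sum (fun n => RInt (f n) 0 (2 * PI)) N + (2 * PI - 0) * e)).
  { refine (is_RInt_plus (V := R_NormedModule) (fun t => 4 * partial_sum (fun n => f n t) N)
      (fun _ => e) _ _ _ _ _ _).
    - refine (is_RInt_scal (V := R_NormedModule) _ _ _ 4 _ _).
      apply is_RInt_partial_sum; intros n; apply (RInt_correct (f n)), Hf.
    - exact (is_RInt_const (V := R_NormedModule) 0 (2 * PI) e). }
  eapply Rle_trans; [apply (RInt_le _ (fun t => 4 * partial_sum (fun n => f n t) N + e));
    [lra|exact HG|eexists; exact IS|]|].
  - intros t _.
    pose proof (Cmod_taylor_lim_rate z hB (polar x t) delta l N hd (hp t)) as R1.
    pose proof (rpow_taylor_le z (polar x t) delta q l N (proj1 hB) hd (hp t) hl hq hlq) as R2.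
    assert (R3 : Cmod (taylor_lim z l (polar x t))
      <= Cmod (taylor z N (polar x t) l)
         + Cmod (taylor_lim z l (polar x t) - taylor z N (polar x t) l)%C).
    { eapply Rle_trans; [|apply Cmod_triangle]; right; f_equal; ring. }
    apply (rpow_le_compat _ _ q) in R3; [|lra].
    eapply Rle_trans; [exact R3|].
    eapply Rle_trans; [apply rpow_subadditive; try apply Cmod_ge_0; exact Hq1|].
    apply Rplus_le_compat.
    + eapply Rle_trans; [exact R2|]; apply Rmult_le_compat_l; [lra|].
      apply partial_sum_le; intros n; rewrite hzn; right; reflexivity.
    + apply rpow_le_compat; lra.
  - rewrite (is_RInt_unique _ _ _ _ IS); rewrite Rminus_0_r.
    apply Rplus_le_compat_r; rewrite Rmult_assoc; apply Rmult_le_compat_l; [lra|].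
    eapply Rle_trans; [apply partial_sum_le; exact Hfle|].
    rewrite partial_sum_scal; apply Rmult_le_compat_l; [lra|apply HM]. }
assert (L : Rbar_le (RInt (fun t => rpow (Cmod (taylor_lim z l (polar x t))) q) 0 (2 * PI))
  (4 * K * M)); [|exact L].
apply is_lim_seq_le with (fun _ => RInt (fun t => rpow (Cmod (taylor_lim z l (polar x t))) q) 0 (2 * PI))
  (fun N => 4 * K * M + 2 * PI * rpow (2 * conv_rate z delta l N) q).
- exact step.
- apply is_lim_seq_const.
- replace (Finite (4 * K * M)) with (Finite (4 * K * M + 2 * PI * 0)) by (f_equal; ring).
  apply is_lim_seq_plus'; [apply is_lim_seq_const|].
  apply (is_lim_seq_scal_l _ (2 * PI) 0), rpow_lim0; [exact hq|].
  replace (Finite 0) with (Rbar_mult 2 0) by (simpl; f_equal; ring).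
  apply is_lim_seq_scal_l, conv_rate_lim; exact hB.
Qed.

Lemma Cmod_taylor_lim_le (z : nat -> C) (w : C) (delta : R) (k : nat) :
  Blaschke_sequence z -> 0 < delta -> Cmod w <= 1 - delta ->
  Cmod (taylor_lim z k w) <= / (delta / 3) ^ k.
Proof.
intros hB hd hw.
assert (L : Rbar_le (Cmod (taylor_lim z k w)) (/ (delta / 3) ^ k)); [|exact L].
apply is_lim_seq_le with (fun _ => Cmod (taylor_lim z k w))
  (fun N => / (delta / 3) ^ k + 2 * conv_rate z delta k N).
- intros N; pose proof (Cmod_taylor_lim_rate z hB w delta k N hd hw).
  pose proof (Cmod_taylor_le z w delta (proj1 hB) hd hw N k).
  pose proof (Cmod_minus_triangle (taylor_lim z k w) (taylor z N w k)); lra.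
- apply is_lim_seq_const.
- replace (Finite (/ (delta / 3) ^ k)) with (Finite (/ (delta / 3) ^ k + 2 * 0))
    by (f_equal; ring).
  apply is_lim_seq_plus'; [apply is_lim_seq_const|].
  apply (is_lim_seq_scal_l _ 2 0), conv_rate_lim; exact hB.
Qed.

(* For [p > q] the extra factor [|B^(l)| ^ (p - q)] is estimated by its maximum. *)
Lemma circle_integral_bound (z : nat -> C) (r theta : nat -> R) (l : nat) (p q : R) :
  Blaschke_sequence z -> (forall n, 0 < r n < 1) ->
  (forall n, z n = polar (r n) (theta n)) ->
  (1 <= l)%nat -> 0 < q -> INR l * q <= 1 -> 1 < (INR l + 1) * q -> q <= p ->
  exists K, 0 < K /\ forall x M, 0 < x < 1 ->
  (forall N, partial_sum (fun n => Rpower (1 - r n) q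
     * Rpower (1 - r n * x) (1 - (INR l + 1) * q)) N <= M) ->
  0 <= circle_integral (C_derive_n (Blaschke_product z) l) p x
    <= K * (Rpower (1 - x) (- (INR l * (p - q))) * M).
Proof.
intros hB hr hz hl hq hlq hs hpq.
set (s := (INR l + 1) * q) in *.
set (K := 4 * (2 * Rpower 12 s / (s - 1))).
assert (HK : 0 < K).
{ unfold K; pose proof (Rpower_gt0 12 s).
  apply Rmult_lt_0_compat; [lra|apply Rdiv_lt_0_compat; lra]. }
set (F := INR (fact l)); assert (HF : 0 < F) by apply INR_fact_lt_0.
(* [F = l!] converts Taylor coefficients into derivatives, [3] comes from the radius [(1 - x) / 3]
   in the maximum estimate, and [K] is the constant of the [q]-mean. *)
exists (Rpower F p * Rpower 3 (INR l * (p - q)) * K).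
split.
{ apply Rmult_lt_0_compat; [apply Rmult_lt_0_compat; apply Rpower_gt0|exact HK]. }
intros x M hx HM.
set (G := fun t => Cmod (taylor_lim z l (polar x t))).
assert (hp : forall t, Cmod (polar x t) <= 1 - (1 - x)).
{ intros t; rewrite Cmod_polar by lra; lra. }
assert (HG : forall u, 0 < u -> ex_RInt (fun t => rpow (G t) u) 0 (2 * PI)).
{ intros u hu; apply ex_RInt_cont; intros t.
  apply continuous_rpow_taylor_lim; [exact hB|exact hu|lra]. }
pose proof PI_RGT_0 as Hpi.
assert (E : circle_integral (C_derive_n (Blaschke_product z) l) p x
  = Rpower F p * RInt (fun t => rpow (G t) p) 0 (2 * PI)).
{ unfold circle_integral.
  rewrite (RInt_ext _ (fun t => Rpower F p * rpow (G t) p)).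
  - apply (RInt_scal (V := R_CompleteNormedModule)); apply HG; lra.
  - intros t _; rewrite C_derive_n_Blaschke by (try exact hB; pose proof (hp t); lra).
    unfold Cnat; fold F; rewrite Cmod_mult, Cmod_R, Rabs_pos_eq by lra.
    rewrite rpow_mult by (try apply Cmod_ge_0; lra); rewrite (rpow_pos F) by exact HF.
    reflexivity. }
rewrite E; pose proof (Rpower_gt0 F p) as HFp.
split.
{ apply Rmult_le_pos; [lra|]; apply RInt_ge_0; [lra|apply HG; lra|].
  intros; apply rpow_ge0. }
(* The [(p - q)]-th power of the bound of [Cmod_taylor_lim_le] for [delta = 1 - x]. *)
set (D := Rpower 3 (INR l * (p - q)) * Rpower (1 - x) (- (INR l * (p - q)))).
assert (HD : 0 < D) by (apply Rmult_lt_0_compat; apply Rpower_gt0).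
assert (HDE : D = Rpower (/ ((1 - x) / 3) ^ l) (p - q)).
{ unfold D; rewrite <- pow_inv, <- Rpower_pow, Rpower_mult
    by (apply Rinv_0_lt_compat; lra).
  replace (/ ((1 - x) / 3)) with (3 * / (1 - x)) by (field; lra).
  rewrite <- Rpower_mult_distr by (try apply Rinv_0_lt_compat; lra); f_equal.
  rewrite <- (Rpower_1 (/ (1 - x))) by (apply Rinv_0_lt_compat; lra).
  rewrite <- (Rpower_1 (1 - x)) at 2 by lra.
  rewrite <- Rpower_Ropp, !Rpower_mult; f_equal; ring. }
assert (I1 : RInt (fun t => rpow (G t) p) 0 (2 * PI)
  <= D * RInt (fun t => rpow (G t) q) 0 (2 * PI)).
{ assert (ES : RInt (fun t => D * rpow (G t) q) 0 (2 * PI)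
    = D * RInt (fun t => rpow (G t) q) 0 (2 * PI)).
  { apply (RInt_scal (V := R_CompleteNormedModule)); apply HG; exact hq. }
  rewrite <- ES; apply RInt_le; [lra|apply HG; lra| |].
  - apply (ex_RInt_scal (V := R_NormedModule)), HG; exact hq.
  - intros t _; destruct (Rlt_dec 0 (G t)) as [Hpos|Hneg].
    + rewrite !rpow_pos by exact Hpos.
      replace p with ((p - q) + q) at 1 by ring; rewrite Rpower_plus.
      apply Rmult_le_compat_r; [apply Rlt_le, Rpower_gt0|].
      rewrite HDE; apply Rle_Rpower_l; [lra|split; [exact Hpos|]].
      apply Cmod_taylor_lim_le; [exact hB|lra|apply hp].
    + rewrite !rpow_nonpos by lra; lra. }
pose proof (circle_mean_taylor_lim z r theta l q x M hB hr hz hl hq hlq hs hx HM) as I2.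
fold s K in I2; fold G in I2.
change (RInt (fun t => rpow (G t) q) 0 (2 * PI) <= K * M) in I2.
apply Rle_trans with (Rpower F p * (D * (K * M))).
- apply Rmult_le_compat_l; [lra|]; eapply Rle_trans; [exact I1|].
  apply Rmult_le_compat_l; lra.
- right; unfold D; ring.
Qed.

(** Applied with [t = 1 - r_n], [s = 1 - x], [u = 1 - r_n x] and [b = (l+1) q - 1], so that
    [q - b = 1 - l q]. As [- b < 0], [u] may be lowered to the larger of [t] and [s]; the power of
    [h] to compare then has exponent [q] or [q - b]. *)
Lemma weight_bound (h : R -> R) (q b t s u : R) :
  (forall y, 0 < y < 1 -> 0 < h y) -> 0 < b ->
  weakly_decreasing_on 0 1 (fun y => h y / Rpower y q) ->
  weakly_increasing_on 0 1 (fun y => h y / Rpower y (q - b)) ->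
  0 < t < 1 -> 0 < s < 1 -> t <= u -> s <= u ->
  Rpower t q * Rpower u (- b) <= h t * (Rpower s (q - b) / h s).
Proof.
intros hpos ha hdec hinc ht hs htu hsu.
pose proof (hpos t ht) as Ht; pose proof (hpos s hs) as Hs.
assert (cross : forall e, h s / Rpower s e <= h t / Rpower t e ->
  Rpower t e <= h t * (Rpower s e / h s)).
{ intros e H; pose proof (Rpower_gt0 s e); pose proof (Rpower_gt0 t e).
  apply Rmult_le_reg_r with (h s / Rpower s e / Rpower t e).
  - apply Rdiv_lt_0_compat; [apply Rdiv_lt_0_compat|]; assumption.
  - replace (Rpower t e * (h s / Rpower s e / Rpower t e)) with (h s / Rpower s e)
      by (field; lra).
    replace (h t * (Rpower s e / h s) * (h s / Rpower s e / Rpower t e))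
      with (h t / Rpower t e) by (field; lra).
    exact H. }
assert (shift : forall y, 0 < y < 1 -> Rpower y (q - b) = Rpower y q * Rpower y (- b)).
{ intros y _; rewrite <- Rpower_plus; f_equal; ring. }
destruct (Rle_dec t s) as [H|H].
- apply Rle_trans with (Rpower t q * Rpower s (- b)).
  + apply Rmult_le_compat_l; [apply Rlt_le, Rpower_gt0|].
    apply Rpower_le_contravar; lra.
  + rewrite shift by exact hs.
    pose proof (cross q (hdec t s (proj1 ht) H (proj2 hs))) as C1.
    apply Rmult_le_compat_r with (r := Rpower s (- b)) in C1;
      [|apply Rlt_le, Rpower_gt0].
    eapply Rle_trans; [exact C1|]; right; field; lra.
- apply Rle_trans with (Rpower t q * Rpower t (- b)).
  + apply Rmult_le_compat_l; [apply Rlt_le, Rpower_gt0|].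
    apply Rpower_le_contravar; lra.
  + rewrite <- shift by exact ht; apply cross.
    apply (hinc s t (proj1 hs) ltac:(lra) (proj2 ht)).
Qed.

(** * Asymptotics *)

Lemma at_left_1_intro (P : R -> Prop) (d : posreal) :
  (forall x, 0 < x < 1 -> 1 - x < d -> P x) -> at_left 1 P.
Proof.
intros H.
assert (Hd : 0 < Rmin 1 d) by (apply Rmin_glb_lt; [lra|apply cond_pos]).
exists (mkposreal _ Hd); intros x Hx Hx1; change (Rabs (x - 1) < Rmin 1 d) in Hx.
rewrite Rabs_left in Hx by lra.
pose proof (Rmin_l 1 d); pose proof (Rmin_r 1 d); apply H; lra.
Qed.

(** The first [N1] terms cost at most [1] each and the others at most [c] times the tail of [H]. The
    head does not involve [c], so it becomes negligible when [c] is large. *)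
Lemma partial_sum_split (A H : nat -> R) (c : R) (N1 N : nat) :
  0 <= c -> (forall n, 0 <= H n) -> ex_series H ->
  (forall n, 0 <= A n <= 1) -> (forall n, A n <= H n * c) ->
  partial_sum A N <= INR N1 + c * tail_sum H N1.
Proof.
intros Hc HH Hs HA1 HAH.
assert (Ht : forall M, (N1 <= M)%nat -> partial_sum H M - partial_sum H N1 <= tail_sum H N1).
{ intros M _; unfold tail_sum; pose proof (partial_sum_le_Series H M HH Hs); lra. }
assert (HN1 : forall M, partial_sum A M <= INR M).
{ intros M; induction M as [|M IH]; [simpl; lra|].
  rewrite S_INR; simpl; pose proof (HA1 M); lra. }
assert (step : forall M, (N1 <= M)%nat ->
  partial_sum A M <= INR N1 + c * (partial_sum H M - partial_sum H N1)).
{ intros M HM; induction HM as [|M HM IH].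
  - pose proof (HN1 N1); lra.
  - simpl; pose proof (HAH M); lra. }
destruct (Nat.le_gt_cases N1 N) as [Hle|Hgt].
- eapply Rle_trans; [apply step; exact Hle|].
  apply Rplus_le_compat_l, Rmult_le_compat_l; [exact Hc|apply Ht; exact Hle].
- apply Rle_trans with (INR N1 + c * (partial_sum H N1 - partial_sum H N1)).
  + eapply Rle_trans; [|apply step; lia].
    apply partial_sum_incr; [apply HA1|lia].
  + apply Rplus_le_compat_l, Rmult_le_compat_l; [exact Hc|apply Ht; lia].
Qed.

Theorem theorem4p1 (l : nat) (hl : (1 <= l)%nat)
  (h : R -> R)
  (h_pos : forall t, 0 < t < 1 -> 0 < h t)
  (h_cont : forall t, 0 < t < 1 -> continuous h t)
  (h_lim : filterlim h (at_right 0) (locally 0))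
  (z : nat -> C) (r theta : nat -> R)
  (hr : forall n, 0 < r n < 1)
  (hz : forall n, z n = polar (r n) (theta n))
  (hB : Blaschke_sequence z)
  (h_sum : ex_series (fun n => h (1 - r n)))
  (q : R) (hq : 1 / (INR l + 1) < q <= 1 / INR l)
  (h_decr : weakly_decreasing_on 0 1 (fun t => h t / Rpower t q))
  (h_incr : weakly_increasing_on 0 1 (fun t => h t / Rpower t (1 - INR l * q))) :
  (forall p : R, q <= p ->
     is_bigO (at_left 1)
       (fun x => 1 / (Rpower (1 - x) (INR l * p - 1) * h (1 - x)))
       (fun x => circle_integral (C_derive_n (Blaschke_product z) l) p x)) /\
  (filterlim (fun t => h t / Rpower t (1 - INR l * q)) (at_right 0) (locally 0) ->
   forall p : R, q <= p ->
     is_domin (at_left 1)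
       (fun x => 1 / (Rpower (1 - x) (INR l * p - 1) * h (1 - x)))
       (fun x => circle_integral (C_derive_n (Blaschke_product z) l) p x)).
Proof.
assert (hl1 : 1 <= INR l) by (change 1 with (INR 1); apply le_INR; exact hl).
assert (hs : 1 < (INR l + 1) * q).
{ apply Rmult_lt_reg_r with (/ (INR l + 1)); [apply Rinv_0_lt_compat; lra|].
  replace ((INR l + 1) * q * / (INR l + 1)) with q by (field; lra); lra. }
assert (hlq : INR l * q <= 1).
{ apply Rmult_le_reg_r with (/ INR l); [apply Rinv_0_lt_compat; lra|].
  replace (INR l * q * / INR l) with q by (field; lra); lra. }
assert (hq0 : 0 < q) by nra.
set (b := (INR l + 1) * q - 1); assert (hb : 0 < b) by (unfold b; lra).
set (e := 1 - INR l * q) in *.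
assert (hqb : q - b = e) by (unfold b, e; ring).
set (H := fun n => h (1 - r n)) in *.
assert (hH : forall n, 0 <= H n).
{ intros n; apply Rlt_le, h_pos; pose proof (hr n); lra. }
(* Up to a constant, [A x n] is the share of the [n]-th zero in the [q]-mean. [c x] is the
   reciprocal of [h t / t ^ e] at [t = 1 - x], so it tends to infinity under the little-o
   hypothesis. *)
set (A := fun x n => Rpower (1 - r n) q * Rpower (1 - r n * x) (1 - (INR l + 1) * q)).
set (c := fun x => Rpower (1 - x) e / h (1 - x)).
assert (hc : forall x, 0 < x < 1 -> 0 < c x).
{ intros x hx; apply Rdiv_lt_0_compat; [apply Rpower_gt0|apply h_pos; lra]. }
assert (hA0 : forall x n, 0 <= A x n).
{ intros x n; apply Rlt_le, Rmult_lt_0_compat; apply Rpower_gt0. }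
assert (hAH : forall x n, 0 < x < 1 -> A x n <= H n * c x).
{ intros x n hx; unfold A, H, c; pose proof (hr n); rewrite <- hqb.
  replace (1 - (INR l + 1) * q) with (- b) by (unfold b; ring).
  apply weight_bound; try assumption; try lra; try nra.
  rewrite hqb; exact h_incr. }
(* Since [1 - r n * x >= 1 - r n] and the second exponent is negative, [A x n <= (1 - r n) ^ e],
   with [e >= 0] by [q <= 1/l]. *)
assert (hA1 : forall x n, 0 < x < 1 -> 0 <= A x n <= 1).
{ intros x n hx; split; [apply hA0|]; pose proof (hr n).
  unfold A; apply Rle_trans with (Rpower (1 - r n) q * Rpower (1 - r n) (1 - (INR l + 1) * q)).
  - apply Rmult_le_compat_l; [apply Rlt_le, Rpower_gt0|].
    apply Rpower_le_contravar; [nra|lra].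
  - rewrite <- Rpower_plus; replace (q + (1 - (INR l + 1) * q)) with e by (unfold e; ring).
    assert (he : 0 <= e) by (unfold e; lra).
    apply Rle_trans with (Rpower 1 e); [apply Rle_Rpower_l; lra|].
    unfold Rpower; rewrite ln_1, Rmult_0_r, exp_0; lra. }
assert (main : forall p, q <= p -> exists K, 0 < K /\ forall x M, 0 < x < 1 ->
  (forall N, partial_sum (A x) N <= M * c x) ->
  norm (circle_integral (C_derive_n (Blaschke_product z) l) p x)
  <= K * M * norm (1 / (Rpower (1 - x) (INR l * p - 1) * h (1 - x)))).
{ intros p hp.
  destruct (circle_integral_bound z r theta l p q hB hr hz hl hq0 hlq hs hp) as [K [HK HJ]].
  exists K; split; [exact HK|]; intros x M hx HM.
  destruct (HJ x (M * c x) hx HM) as [J0 J1].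
  pose proof (h_pos (1 - x) ltac:(lra)) as Hh.
  pose proof (Rpower_gt0 (1 - x) (INR l * p - 1)) as Hp.
  change norm with Rabs; rewrite !Rabs_pos_eq.
  - eapply Rle_trans; [exact J1|]; right; unfold c.
    (* The exponents match because [- l (p - q) + e = - (l p - 1)]: the power of [1 - x] in [c]
       cancels the dependence on [q]. *)
    replace (- (INR l * (p - q))) with (- (INR l * p - 1) + - e) by (unfold e; ring).
    rewrite Rpower_plus, !Rpower_Ropp; pose proof (Rpower_gt0 (1 - x) e); field; lra.
  - apply Rlt_le, Rdiv_lt_0_compat; [lra|apply Rmult_lt_0_compat; assumption].
  - exact J0. }
split.
- intros p hp; destruct (main p hp) as [K [HK HJ]].
  exists (K * Series H); apply (at_left_1_intro _ (mkposreal 1 Rlt_0_1)).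
  intros x hx _; apply (HJ x (Series H) hx); intros N.
  apply Rle_trans with (partial_sum (fun n => c x * H n) N).
  + apply partial_sum_le; intros n; rewrite Rmult_comm; apply hAH; exact hx.
  + rewrite partial_sum_scal, Rmult_comm.
    apply Rmult_le_compat_r; [apply Rlt_le, hc; exact hx|].
    apply partial_sum_le_Series; assumption.
- intros hlim p hp eps; destruct (main p hp) as [K [HK HJ]].
  (* One half for the finite head, the other for the tail of [H]. [N1] is fixed first by the tail;
     closeness of [x] to [1] is then chosen depending on [N1]. *)
  set (eps' := eps / K / 2).
  assert (Heps' : 0 < eps').
  { unfold eps'; pose proof (cond_pos eps); apply Rdiv_lt_0_compat; [|lra].
    apply Rdiv_lt_0_compat; assumption. }
  pose proof (tail_sum_lim H h_sum) as T; apply is_lim_seq_spec in T.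
  destruct (T (mkposreal _ Heps')) as [N1 HN1].
  specialize (HN1 N1 (le_n _)); simpl in HN1; rewrite Rminus_0_r in HN1.
  apply Rabs_def2 in HN1.
  pose proof (pos_INR N1) as HI.
  (* The [+ 1] keeps the threshold meaningful when [N1 = 0]; below it, [INR N1 + 1 < eps' * c x], so
     the head is absorbed. *)
  assert (Hd : 0 < eps' / (INR N1 + 1)) by (apply Rdiv_lt_0_compat; lra).
  destruct (hlim _ (locally_ball 0 (mkposreal _ Hd))) as [d Hd'].
  apply (at_left_1_intro _ d); intros x hx hxd.
  replace (pos eps) with (K * (2 * eps')) by (unfold eps'; field; lra).
  apply (HJ x (2 * eps') hx); intros N.
  pose proof (hc x hx) as Hc.
  eapply Rle_trans; [apply (partial_sum_split (A x) H (c x) N1 N (Rlt_le _ _ Hc) hH h_sum)|].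
  + intros n; apply hA1; exact hx.
  + intros n; apply hAH; exact hx.
  + assert (B : h (1 - x) / Rpower (1 - x) e < eps' / (INR N1 + 1)).
    { assert (ball 0 (eps' / (INR N1 + 1)) (h (1 - x) / Rpower (1 - x) e)) as Bb.
      { apply (Hd' (1 - x)); [|lra].
        change (Rabs (1 - x - 0) < d); rewrite Rminus_0_r, Rabs_pos_eq; lra. }
      change (Rabs (h (1 - x) / Rpower (1 - x) e - 0) < eps' / (INR N1 + 1)) in Bb.
      rewrite Rminus_0_r in Bb; apply Rabs_def2 in Bb; lra. }
    assert (HN : INR N1 <= eps' * c x).
    { pose proof (Rpower_gt0 (1 - x) e); pose proof (h_pos (1 - x) ltac:(lra)).
      apply Rmult_lt_compat_r with (r := c x * (INR N1 + 1)) in B; [|nra].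
      replace (h (1 - x) / Rpower (1 - x) e * (c x * (INR N1 + 1))) with (INR N1 + 1) in B
        by (unfold c; field; lra).
      replace (eps' / (INR N1 + 1) * (c x * (INR N1 + 1))) with (eps' * c x) in B
        by (field; lra).
      lra. }
    nra.
Qed.
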